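(* Every aligned spatial E$_0$-semigroup is prime. That is, let $\alpha$ be an E$_0$-semigroup acting on $\mathfrak{B}(\mathfrak{H})$ which is spatial and aligned. If $\alpha$ is cocycle conjugate to $\beta\otimes\gamma$, where $\beta$ and $\gamma$ are E$_0$-semigroups, then $\beta$ or $\gamma$ is of type I$_0$.
   Context: All Hilbert spaces $\mathfrak{H}$ on which semigroups act are separable and infinite-dimensional; $\mathfrak{B}(\mathfrak{H})$ is the algebra of bounded operators on $\mathfrak{H}$. A CP-semigroup acting on $\mathfrak{B}(\mathfrak{H})$ is a point-$\sigma$-weakly continuous semigroup $\alpha=\{\alpha_t:\mathfrak{B}(\mathfrak{H})\to\mathfrak{B}(\mathfrak{H})\}_{t\ge 0}$ of normal completely positive contractions with $\alpha_0=\mathrm{id}$. If each $\alpha_t$ is a ($*$-)endomorphism with $\alpha_t(I)=I$, then $\alpha$ is an E$_0$-semigroup. Subordination: a CP-semigroup $\beta$ is a subordinate of a CP-semigroup $\alpha$ (equivalently, $\alpha$ dominates $\beta$) if both act on the same $\mathfrak{B}(\mathfrak{H})$ and $\alpha_t-\beta_t$ is completely positive for all $t\ge 0$. A subordinate $\beta$ of $\alpha$ is trivially maximal if for every $k>0$ the semigroup $(e^{kt}\beta_t)_{t\ge 0}$ is not a subordinate of $\alpha$. $\mathfrak{S}(\alpha)$ denotes the set of all trivially maximal subordinates of $\alpha$, partially ordered by subordination. $\alpha$ is aligned if $\mathfrak{S}(\alpha)$ is totally ordered. A unit of an E$_0$-semigroup $\alpha$ is a strongly continuous semigroup $(U_t)_{t\ge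 0}$ of bounded operators on $\mathfrak{H}$ with $U_0=I$ and $\alpha_t(x)U_t=U_tx$ for all $x\in\mathfrak{B}(\mathfrak{H})$, $t\ge 0$. $\alpha$ is spatial if it has a unit. $\alpha$ is of type I$_0$ if every $\alpha_t$ is a $*$-automorphism of $\mathfrak{B}(\mathfrak{H})$. Tensor product: for E$_0$-semigroups $\beta$ on $\mathfrak{B}(\mathfrak{H}_1)$ and $\gamma$ on $\mathfrak{B}(\mathfrak{H}_2)$, $\beta\otimes\gamma$ is the E$_0$-semigroup on $\mathfrak{B}(\mathfrak{H}_1\otimes\mathfrak{H}_2)$ determined by $(\beta\otimes\gamma)_t(x\otimes y)=\beta_t(x)\otimes\gamma_t(y)$. Cocycle conjugacy: E$_0$-semigroups $\alpha$ on $\mathfrak{B}(\mathfrak{H}_1)$ and $\beta$ on $\mathfrak{B}(\mathfrak{H}_2)$ are cocycle conjugate if there are a unitary $W:\mathfrak{H}_1\to\mathfrak{H}_2$ and a strongly continuous family $(C_t)_{t\ge 0}$ of unitaries in $\mathfrak{B}(\mathfrak{H}_2)$ with $C_{t+s}=C_t\beta_t(C_s)$ for all $t,s\ge 0$, such that $W\alpha_t(W^*xW)W^*=C_t\beta_t(x)C_t^*$ for all $x\in\mathfrak{B}(\mathfrak{H}_2)$, $t\ge 0$. An E$_0$-semigroup $\alpha$ is prime if, whenever $\alpha$ is cocycle conjugate to $\beta\otimes\gamma$ with $\beta$ and $\gamma$ E$_0$-semigroups, $\beta$ or $\gamma$ is of type I$_0$. *)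

(* Defs.v *)
From HB Require Import structures.
From mathcomp Require Import all_boot all_order all_algebra.
From mathcomp Require Import sesquilinear complex.
From mathcomp Require Import all_classical all_reals topology normedtype.
From mathcomp Require Import sequences exp.
Set Implicit Arguments.
Unset Strict Implicit.
Unset Printing Implicit Defensive.
Import Order.TTheory GRing.Theory Num.Theory Num.Def.
Import numFieldNormedType.Exports.
Local Open Scope classical_set_scope.
Local Open Scope ring_scope.
Local Open Scope complex_scope.

(* The inner product is linear in its first argument. *)
Record hilbert (R : realType) := Hilbert {
  hcar :> completeNormedModType R[i] ;
  ip : {dot hcar for @conjC R[i]} ;
  norm_ip : forall x : hcar, `|x| ^+ 2 = ip x x ;
  hilbert_separable : exists2 D : set hcar, countable D & dense D ;
  hilbert_infinite_dim : ~ exists n (e : 'I_n -> hcar),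
    forall x, exists c : 'I_n -> R[i], x = \sum_(i < n) c i *: e i }.

Definition bounded_operator (R : realType) (H K : hilbert R) : {pred H -> K} :=
  mem [set f : H -> K | linear f /\ exists M, forall x, `|f x| <= M * `|x|].

Arguments bounded_operator {R} H K.

Lemma bounded_operator_submod (R : realType) (H K : hilbert R) :
  submod_closed (bounded_operator H K).
Proof.
split=> [|a f g].
  apply/mem_set; split=> [b x y /=|]; first by rewrite scaler0 addr0.
  by exists 0 => x; rewrite normr0 mul0r.
move=> /set_mem[lf [M Mf]] /set_mem[lg [N Ng]]; apply/mem_set; split.
  move=> b x y; rewrite !fctE lf lg !scalerDr !scalerA -!addrA (mulrC a b).
  by congr (_ + _); rewrite addrCA.
exists (`|a| * M + N) => x; rewrite mulrDl.
apply: (le_trans (ler_normD _ _)); apply: lerD => //.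
by rewrite normrZ -mulrA ler_wpM2l.
Qed.

HB.instance Definition _ (R : realType) (H K : hilbert R) :=
  GRing.isSubmodClosed.Build _ _ (bounded_operator H K)
    (bounded_operator_submod H K).

Record bop (R : realType) (H K : hilbert R) := Bop {
  bop_fun :> H -> K ;
  bopP : bop_fun \in bounded_operator H K }.

HB.instance Definition _ (R : realType) (H K : hilbert R) :=
  [isSub for @bop_fun R H K].
HB.instance Definition _ (R : realType) (H K : hilbert R) :=
  [Choice of bop H K by <:].
HB.instance Definition _ (R : realType) (H K : hilbert R) :=
  [SubChoice_isSubLmodule of bop H K by <:].

Notation "''B' ( H )" := (bop H H) (at level 8, format "''B' ( H )").

Lemma bid_subproof (R : realType) (H : hilbert R) :
  (fun x : H => x) \in bounded_operator H H.
Proof. by apply/mem_set; split=> //; exists 1 => x; rewrite mul1r. Qed.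

Definition bid (R : realType) (H : hilbert R) : 'B(H) := Bop (bid_subproof H).

Lemma bcomp_subproof (R : realType) (H K L : hilbert R)
    (x : bop K L) (y : bop H K) :
  (fun v => x (y v)) \in bounded_operator H L.
Proof.
case: x y => f /set_mem[lf [M Mf]] [g /set_mem[lg [N Ng]]] /=.
apply/mem_set; split=> [a u v|]; first by rewrite lg lf.
exists (`|M| * `|N|) => v; apply: (le_trans (Mf _)).
have nr (z : R[i]) u : 0 <= z * `|u : H| -> z * `|u| <= `|z| * `|u|.
  by move=> z0; rewrite -[leLHS]ger0_norm // normrM normr_id.
have N1 : `|g v| <= `|N| * `|v|.
  by apply: (le_trans (Ng v)); apply: nr; apply: le_trans (Ng v).
have : M * `|g v| <= `|M| * `|g v|.
  by rewrite -[leLHS]ger0_norm ?normrM ?normr_id // (le_trans _ (Mf _)).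
by move=> /le_trans; apply; rewrite -mulrA ler_wpM2l.
Qed.

Definition bcomp (R : realType) (H K L : hilbert R)
  (x : bop K L) (y : bop H K) : bop H L := Bop (bcomp_subproof x y).

Notation "x \oB y" := (bcomp x y) (at level 40, left associativity).

(* [adjoint x] is the unique [y] in the set below, which exists by the Riesz
   representation theorem. *)
Definition adjoint (R : realType) (H K : hilbert R) (x : bop H K) : bop K H :=
  xget 0 [set y : bop K H | forall v w, ip K (x v) w = ip H v (y w)].

Definition unitary (R : realType) (H K : hilbert R) (x : bop H K) : Prop :=
  adjoint x \oB x = bid H /\ x \oB adjoint x = bid K.

Definition opnorm (R : realType) (H K : hilbert R) (x : bop H K) : R :=
  sup [set complex.Re `|x v| | v in [set v : H | `|v| <= 1]].

Section SigmaWeak.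
Variables (R : realType) (H : hilbert R).

Definition square_summable (xi : nat -> H) : Prop :=
  cvgn (series (fun n => `|xi n| ^+ 2) : nat -> R[i]^o).

Definition sigma_weak_index := {p : (nat -> H) * (nat -> H) |
  square_summable p.1 /\ square_summable p.2}.

Definition sigma_weak_form (p : sigma_weak_index) (x : 'B(H)) : R[i]^o :=
  limn (series (fun n => ip H (x ((sval p).1 n)) ((sval p).2 n))
        : nat -> R[i]^o).

Definition sigma_weak_topology :=
  sup_topology (fun p : sigma_weak_index =>
    Topological.class (initial_topology (sigma_weak_form p))).

HB.instance Definition _ := Topological.on sigma_weak_topology.

Definition normal_map (phi : 'B(H) -> 'B(H)) : Prop :=
  continuous (phi : sigma_weak_topology -> sigma_weak_topology).

(* Positivity of [a] as an operator on the n-fold direct sum of [H]; over the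
   complex numbers [0 <= z] includes that [z] is real. *)
Definition positive_mx (n : nat) (a : 'M['B(H)]_n) : Prop :=
  forall v : 'I_n -> H,
    0 <= \sum_(i < n) \sum_(j < n) ip H (a i j (v j)) (v i).

Definition completely_positive (phi : 'B(H) -> 'B(H)) : Prop :=
  linear phi /\
  forall n (a : 'M['B(H)]_n), positive_mx a -> positive_mx (map_mx phi a).

Definition norm_contraction (phi : 'B(H) -> 'B(H)) : Prop :=
  forall x, opnorm (phi x) <= opnorm x.

Definition star_endomorphism (phi : 'B(H) -> 'B(H)) : Prop :=
  [/\ linear phi, forall x y, phi (x \oB y) = phi x \oB phi y
    & forall x, phi (adjoint x) = adjoint (phi x)].

End SigmaWeak.

(* One-parameter families indexed by [0, +oo[ are functions on [R] of which only
   the values at nonnegative times matter. *)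
Definition strongly_continuous (R : realType) (H : hilbert R)
    (U : R -> 'B(H)) : Prop :=
  forall v : H, {within `[0, +oo[, continuous (fun t : R => U t v)}.

Section Semigroups.
Variables (R : realType) (H : hilbert R).
Implicit Types alpha beta : R -> 'B(H) -> 'B(H).

Record CP_semigroup alpha : Prop := {
  cps_cp : forall t, 0 <= t -> completely_positive (alpha t) ;
  cps_normal : forall t, 0 <= t -> normal_map (alpha t) ;
  cps_contraction : forall t, 0 <= t -> norm_contraction (alpha t) ;
  cps_0 : forall x, alpha 0 x = x ;
  cps_add : forall s t x, 0 <= s -> 0 <= t ->
    alpha (s + t) x = alpha s (alpha t x) ;
  cps_continuous : forall x,
    {within `[0, +oo[, continuous (fun t : R => alpha t x : sigma_weak_topology H)}
}.

Definition E0_semigroup alpha : Prop :=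
  CP_semigroup alpha /\
  forall t, 0 <= t -> star_endomorphism (alpha t) /\ alpha t (bid H) = bid H.

Definition subordinate beta alpha : Prop :=
  [/\ CP_semigroup beta, CP_semigroup alpha
    & forall t, 0 <= t -> completely_positive (fun x => alpha t x - beta t x)].

Definition trivially_maximal beta alpha : Prop :=
  subordinate beta alpha /\
  forall k : R, 0 < k ->
    ~ subordinate (fun t x => (expR (k * t))%:C *: beta t x) alpha.

Definition aligned alpha : Prop := forall beta gamma,
  trivially_maximal beta alpha -> trivially_maximal gamma alpha ->
  subordinate beta gamma \/ subordinate gamma beta.

Record is_unit alpha (U : R -> 'B(H)) : Prop := {
  unit_continuous : strongly_continuous U ;
  unit_0 : U 0 = bid H ;
  unit_add : forall s t, 0 <= s -> 0 <= t -> U (s + t) = U s \oB U t ;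
  unit_intertwine : forall t x, 0 <= t -> alpha t x \oB U t = U t \oB x }.

Definition spatial alpha : Prop := exists U, is_unit alpha U.

Definition type_I0 alpha : Prop :=
  forall t, 0 <= t -> star_endomorphism (alpha t) /\ bijective (alpha t).

End Semigroups.

(* [K] with [tens] is a realization of the Hilbert space tensor product of
   [H1] and [H2]; it is unique up to a unitary carrying one [tens] to the other. *)
Definition is_tensor_product (R : realType) (H1 H2 K : hilbert R)
    (tens : {bilinear H1 -> H2 -> K}) : Prop :=
  (forall v v' w w',
     ip K (tens v w) (tens v' w') = ip H1 v v' * ip H2 w w') /\
  dense [set z : K | exists n (v : 'I_n -> H1) (w : 'I_n -> H2),
           z = \sum_(i < n) tens (v i) (w i)].

Definition is_tensor_operator (R : realType) (H1 H2 K : hilbert R)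
    (tens : {bilinear H1 -> H2 -> K}) (x : 'B(H1)) (y : 'B(H2)) (z : 'B(K))
    : Prop :=
  forall v w, z (tens v w) = tens (x v) (y w).

Definition is_tensor_semigroup (R : realType) (H1 H2 K : hilbert R)
    (tens : {bilinear H1 -> H2 -> K}) (beta : R -> 'B(H1) -> 'B(H1))
    (gamma : R -> 'B(H2) -> 'B(H2)) (delta : R -> 'B(K) -> 'B(K)) : Prop :=
  E0_semigroup delta /\
  forall t x y z, 0 <= t -> is_tensor_operator tens x y z ->
    is_tensor_operator tens (beta t x) (gamma t y) (delta t z).

Definition cocycle (R : realType) (H : hilbert R) (beta : R -> 'B(H) -> 'B(H))
    (C : R -> 'B(H)) : Prop :=
  [/\ strongly_continuous C, forall t, 0 <= t -> unitary (C t)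
    & forall t s, 0 <= t -> 0 <= s -> C (t + s) = C t \oB beta t (C s)].

Definition cocycle_conjugate (R : realType) (H1 H2 : hilbert R)
    (alpha : R -> 'B(H1) -> 'B(H1)) (beta : R -> 'B(H2) -> 'B(H2)) : Prop :=
  exists (W : bop H1 H2) (C : R -> 'B(H2)),
    [/\ unitary W, cocycle beta C
      & forall t x, 0 <= t ->
          W \oB alpha t (adjoint W \oB x \oB W) \oB adjoint W
          = C t \oB beta t x \oB adjoint (C t)].

Definition prime_E0 (R : realType) (H : hilbert R)
    (alpha : R -> 'B(H) -> 'B(H)) : Prop :=
  forall (H1 H2 K : hilbert R) (tens : {bilinear H1 -> H2 -> K})
    (beta : R -> 'B(H1) -> 'B(H1)) (gamma : R -> 'B(H2) -> 'B(H2))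
    (delta : R -> 'B(K) -> 'B(K)),
    E0_semigroup beta -> E0_semigroup gamma ->
    is_tensor_product tens -> is_tensor_semigroup tens beta gamma delta ->
    cocycle_conjugate alpha delta ->
    type_I0 beta \/ type_I0 gamma.

(* Main.v *)
(* Up to normalization a unit of [alpha] gives a unit [V] of [beta (x) gamma] made
   of isometries. Let E and F be the Hilbert spaces of operators intertwining
   [beta t] (resp. [gamma t]) with the identity; [V t] is a unit vector of
   E (x) F, and its partial trace over F is a density matrix rho_t in B(E), the
   commutant of the range of [beta t]. One has rho_(s+t) = rho_s beta_s(rho_t)
   and rho_t -> 1 as t -> 0, so that e^(kt) rho_t (x) 1, for the largest k that
   keeps it contractive, defines a trivially maximal subordinate of
   beta (x) gamma. Exchanging the factors gives a second one,
   e^(lt) 1 (x) sigma_t. Both can be transported to [alpha], hence are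
   comparable; say e^(kt) rho_t (x) 1 >= e^(lt) 1 (x) sigma_t. Then
   rho_t >= c_t where c_t -> 1 as t -> 0. As rho_t has trace 1, E is
   one-dimensional as soon as c_t > 1/2, and [beta t] is then conjugation by a
   unitary; this extends to all t by the semigroup law. *)
Require Import Defs.
From HB Require Import structures.
From mathcomp Require Import all_boot all_order all_algebra.
From mathcomp Require Import sesquilinear complex ring lra.
From mathcomp Require Import all_classical all_reals topology normedtype.
From mathcomp Require Import ereal sequences realfun exp esum.
Set Implicit Arguments.
Unset Strict Implicit.
Unset Printing Implicit Defensive.
Import Order.TTheory GRing.Theory Num.Theory Num.Def.
Import numFieldNormedType.Exports.
Local Open Scope classical_set_scope.
Local Open Scope ring_scope.
Local Open Scope complex_scope.

(** * Complex numbers *)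

(** The spaces E and F are never built. A unit vector [f] and a basis [g j] of [H2] turn [V t] into
    the intertwiners T_j = [coef t j] of [beta t], the slices of [V t] between [f] and [g j]. Then
    rho_t is the strong sum of the T_j T_j^*, and its trace is controlled by the sum of the |T_j
    u|^2, which is at most |V_t (u (x) f)|^2 = 1 for a unit vector u. Multiplicativity of rho
    expresses that tracing out F_(s+t) amounts to tracing out F_s and F_t; on quadratic forms it
    becomes an exchange of nonnegative triple series in the extended reals. Subordinates enter
    through local cocycles: positive contractions A_t in the commutant of the range of alpha_t yield
    the semigroup A_t alpha_t. Comparing two such semigroups at the identity compares the A_t
    themselves, hence their quadratic forms. Continuity is asked of a cocycle only at 0 and only in
    the form <A_t v, v>, which is what the partial trace of a unit provides; the cocycle law
    propagates it to all times. *)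

Section Complex.
Variable R : realType.
Implicit Types a b : R[i].

(** Norms over [R[i]] take values in [R[i]]; squared moduli in [R], and [nsq] for vectors, keep
    estimates and limits real. *)
Definition csq a : R := complex.Re a ^+ 2 + complex.Im a ^+ 2.

Lemma csqE a : (csq a)%:C = `|a| ^+ 2.
Proof. exact: add_Re2_Im2. Qed.

Lemma csqJ a : (csq a)%:C = a * a^*.
Proof. by rewrite csqE sqr_normc. Qed.

Lemma conjCE a : conjC a = a^*.
Proof.
case: (eqVneq a 0) => [->|a0]; first by rewrite conjC0 conjc0.
by apply: (mulfI a0); rewrite -sqr_normc normCK.
Qed.

Lemma conjcM a b : conjc (a * b) = conjc a * conjc b.
Proof. exact: rmorphM. Qed.

Lemma csq_ge0 a : 0 <= csq a.
Proof. by rewrite addr_ge0// sqr_ge0. Qed.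

Lemma csqM a b : csq (a * b) = csq a * csq b.
Proof. case: a b => x y [u v]; rewrite /csq /=; ring. Qed.

(** Two uses of |x + y|^2 <= 2|x|^2 + 2|y|^2, for a three-epsilon argument along a, b, c, d. *)
Lemma csq_chain a b c d :
  csq (a - d) <= 2 * csq (a - b) + 4 * csq (b - c) + 4 * csq (d - c).
Proof.
have real (x y z w : R) :
    (x - w) ^+ 2 <= 2 * (x - y) ^+ 2 + 4 * (y - z) ^+ 2 + 4 * (w - z) ^+ 2.
  have := sqr_ge0 ((x - y) - (y - w)); have := sqr_ge0 ((y - z) - (z - w)).
  by nra.
case: a b c d => [a1 a2] [b1 b2] [c1 c2] [d1 d2].
have := real a1 b1 c1 d1; have := real a2 b2 c2 d2; rewrite /csq /=; lra.
Qed.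

Lemma csqD_le a b : csq (a + b) <= 2 * csq a + 2 * csq b.
Proof.
case: a b => a1 a2 [b1 b2]; rewrite /csq /=.
by have := sqr_ge0 (a1 - b1); have := sqr_ge0 (a2 - b2); nra.
Qed.

Lemma csq_conj a : csq a^* = csq a.
Proof. by case: a => x y; rewrite /csq /= sqrrN. Qed.

Lemma csqN a : csq (- a) = csq a.
Proof. by case: a => x y; rewrite /csq /= !sqrrN. Qed.

Lemma csq_real (x : R) : csq x%:C = x ^+ 2.
Proof. by rewrite /csq /= expr0n addr0. Qed.

Lemma ge0_complex a : 0 <= a -> a = (complex.Re a)%:C.
Proof. by case: a => x y; rewrite lecE /= => /andP[/eqP-> _]. Qed.

Lemma cReM_real (x : R) a : complex.Re (x%:C * a) = x * complex.Re a.
Proof. by case: a => u v; rewrite /= mul0r subr0. Qed.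

Lemma cReD a b : complex.Re (a + b) = complex.Re a + complex.Re b.
Proof. by case: a b => x y []. Qed.

Lemma cReN a : complex.Re (- a) = - complex.Re a.
Proof. by case: a. Qed.

Lemma complex_ge0 a : complex.Im a = 0 -> 0 <= complex.Re a -> 0 <= a.
Proof. by case: a => x y /= -> x0; rewrite lecE /= eqxx. Qed.

Lemma cRe_conj a : complex.Re a^* = complex.Re a.
Proof. by case: a. Qed.

Lemma cRe_sum I (r : seq I) (P : pred I) (F : I -> R[i]) :
  complex.Re (\sum_(i <- r | P i) F i) = \sum_(i <- r | P i) complex.Re (F i).
Proof. by apply: (big_morph _ cReD). Qed.

Lemma cImD a b : complex.Im (a + b) = complex.Im a + complex.Im b.
Proof. by case: a b => x y []. Qed.

Lemma cIm_sum I (r : seq I) (P : pred I) (F : I -> R[i]) :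
  complex.Im (\sum_(i <- r | P i) F i) = \sum_(i <- r | P i) complex.Im (F i).
Proof. by apply: (big_morph _ cImD). Qed.

Lemma cRe_sqr_le a : complex.Re a ^+ 2 <= csq a.
Proof. by rewrite lerDl sqr_ge0. Qed.

Lemma cvg_sqr (T : Type) (F : set_system T) {FF : Filter F} (f : T -> R) (x : R) :
  f t @[t --> F] --> x -> f t ^+ 2 @[t --> F] --> x ^+ 2.
Proof. by move=> fx; rewrite expr2; under eq_fun do rewrite expr2; exact: cvgM. Qed.

Lemma cvg_Re_Im (T : Type) (F : set_system T) {FF : Filter F} (f : T -> R[i]) a :
  complex.Re (f t) @[t --> F] --> complex.Re a ->
  complex.Im (f t) @[t --> F] --> complex.Im a ->
  (f t : R[i]^o) @[t --> F] --> (a : R[i]^o).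
Proof.
move=> /cvgrPdist_lt fr /cvgrPdist_lt fi; apply/cvgrPdist_lt => e e0.
have e0' : 0 < complex.Re e / 2.
  by move: e0; rewrite ltcE /= => /andP[_ h]; rewrite divr_gt0.
have eE : e = (complex.Re e)%:C by apply: ge0_complex; exact: ltW.
near=> t.
rewrite eE normc_def ltcR.
have h1 : `|complex.Re a - complex.Re (f t)| < complex.Re e / 2.
  by near: t; exact: fr.
have h2 : `|complex.Im a - complex.Im (f t)| < complex.Re e / 2.
  by near: t; exact: fi.
set u := a - f t.
have -> : complex.Re u = complex.Re a - complex.Re (f t).
  by rewrite /u; case: (a) (f t) => ? ? [].
have -> : complex.Im u = complex.Im a - complex.Im (f t).
  by rewrite /u; case: (a) (f t) => ? ? [].
set x := _ - _ in h1 *; set y := _ - _ in h2 *.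
have eg : 0 <= complex.Re e by lra.
rewrite -(ger0_norm eg) -sqrtr_sqr ltr_sqrt; last by rewrite exprn_gt0//; lra.
rewrite -(real_normK (num_real x)) -(real_normK (num_real y)).
have := normr_ge0 x; have := normr_ge0 y; nra.
Unshelve. all: end_near. Qed.

Lemma cvg_Re (T : Type) (F : set_system T) {FF : Filter F} (f : T -> R[i]) a :
  (f t : R[i]^o) @[t --> F] --> (a : R[i]^o) ->
  complex.Re (f t) @[t --> F] --> complex.Re a.
Proof.
move=> /cvgrPdist_lt fa; apply/cvgrPdist_lt => e e0; near=> t.
have : `|a - f t| < e%:C by near: t; apply: fa; rewrite ltcR.
rewrite -ltcR; apply: le_lt_trans.
have -> : complex.Re a - complex.Re (f t) = complex.Re (a - f t).
  by case: (a) (f t) => ? ? [].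
exact: normc_ge_Re.
Unshelve. all: end_near. Qed.

Lemma cvg_Im (T : Type) (F : set_system T) {FF : Filter F} (f : T -> R[i]) a :
  (f t : R[i]^o) @[t --> F] --> (a : R[i]^o) ->
  complex.Im (f t) @[t --> F] --> complex.Im a.
Proof.
have E (z : R[i]) : complex.Im z = complex.Re (- 'i%C * z).
  by case: z => x y; rewrite /= oppr0 mul0r sub0r mulN1r opprK.
move=> fa; rewrite E; under eq_fun do rewrite E.
by apply: cvg_Re; apply: cvgMr.
Qed.

Lemma ccvg_sum (T : Type) (F : set_system T) {FF : Filter F} I (r : seq I)
    (P : pred I) (f : I -> T -> R[i]) (a : I -> R[i]) :
  (forall k, (f k t : R[i]^o) @[t --> F] --> (a k : R[i]^o)) ->
  (\sum_(k <- r | P k) f k t : R[i]^o) @[t --> F] --> (\sum_(k <- r | P k) a k : R[i]^o).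
Proof.
move=> fa.
have sum (g : I -> T -> R) (b : I -> R) : (forall k, g k t @[t --> F] --> b k) ->
    \sum_(k <- r | P k) g k t @[t --> F] --> \sum_(k <- r | P k) b k.
  move=> gb; elim: r => [|i r IH].
    by rewrite big_nil; under eq_fun do rewrite big_nil; exact: cvg_cst.
  rewrite big_cons; under eq_fun do rewrite big_cons.
  by case: (P i) => //; apply: cvgD; [exact: gb|exact: IH].
apply: cvg_Re_Im.
  rewrite cRe_sum; under eq_fun do rewrite cRe_sum.
  by apply: sum => k; exact: cvg_Re.
rewrite cIm_sum; under eq_fun do rewrite cIm_sum.
by apply: sum => k; exact: cvg_Im.
Qed.

Lemma cvg_csq (T : Type) (F : set_system T) {FF : Filter F} (f : T -> R[i]) a :
  (f t : R[i]^o) @[t --> F] --> (a : R[i]^o) -> csq (f t - a) @[t --> F] --> (0 : R).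
Proof.
move=> fa.
have -> : 0 = (complex.Re a - complex.Re a) ^+ 2 + (complex.Im a - complex.Im a) ^+ 2.
  by rewrite !subrr expr0n addr0.
have -> : (fun t => csq (f t - a)) = (fun t =>
    (complex.Re (f t) - complex.Re a) ^+ 2 + (complex.Im (f t) - complex.Im a) ^+ 2).
  by apply/funext => t; case: (f t) (a) => ? ? [].
apply: cvgD; apply: cvg_sqr; apply: cvgB; first [exact: cvg_cst|exact: cvg_Re|exact: cvg_Im].
Qed.

End Complex.

(** * Hilbert spaces *)

Section Hilbert.
Variables (R : realType) (H : hilbert R).
Implicit Types (u v w : H) (a : R[i]).

Lemma ipDl u v w : ip H (u + v) w = ip H u w + ip H v w.
Proof. exact: linearDl. Qed.
Lemma ipDr u v w : ip H u (v + w) = ip H u v + ip H u w.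
Proof. exact: linearDr. Qed.
Lemma ipBl u v w : ip H (u - v) w = ip H u w - ip H v w.
Proof. exact: linearBl. Qed.
Lemma ipBr u v w : ip H u (v - w) = ip H u v - ip H u w.
Proof. exact: linearBr. Qed.
Lemma ipNl u v : ip H (- u) v = - ip H u v.
Proof. exact: linearNl. Qed.
Lemma ipNr u v : ip H u (- v) = - ip H u v.
Proof. exact: linearNr. Qed.
Lemma ip0l v : ip H 0 v = 0.
Proof. exact: linear0l. Qed.
Lemma ip0r v : ip H v 0 = 0.
Proof. exact: linear0r. Qed.
Lemma ipZl a u v : ip H (a *: u) v = a * ip H u v.
Proof. by rewrite linearZl_LR. Qed.
Lemma ipZr a u v : ip H u (a *: v) = conjc a * ip H u v.
Proof. by rewrite linearZr_LR /= conjCE. Qed.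
Lemma ip_suml I (r : seq I) (P : pred I) (F : I -> H) v :
  ip H (\sum_(i <- r | P i) F i) v = \sum_(i <- r | P i) ip H (F i) v.
Proof. exact: linear_sumlz. Qed.
Lemma ip_sumr I (r : seq I) (P : pred I) (F : I -> H) v :
  ip H v (\sum_(i <- r | P i) F i) = \sum_(i <- r | P i) ip H v (F i).
Proof. exact: linear_sumr. Qed.
Lemma ipC u v : ip H u v = conjc (ip H v u).
Proof. by rewrite hermC /= expr0 mul1r conjCE. Qed.

Definition nsq v : R := complex.Re (ip H v v).

Lemma ipvv v : ip H v v = (nsq v)%:C.
Proof. by apply: ge0_complex; rewrite -norm_ip exprn_ge0. Qed.

Lemma nsq_ge0 v : 0 <= nsq v.
Proof. by rewrite -(ler0c (nsq v)) -ipvv -norm_ip exprn_ge0. Qed.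

Lemma norm_nsq v : `|v| = (Num.sqrt (nsq v))%:C.
Proof.
apply/eqP; rewrite -(@eqrXn2 _ 2)//; last by rewrite ler0c sqrtr_ge0.
by rewrite norm_ip ipvv -rmorphXn /= sqr_sqrtr ?nsq_ge0.
Qed.

Lemma nsq_norm v : (nsq v)%:C = `|v| ^+ 2.
Proof. by rewrite norm_ip ipvv. Qed.

Lemma nsq_eq0 v : (nsq v == 0) = (v == 0).
Proof.
rewrite -(normr_eq0 v) -(sqrf_eq0 (`|v|)) -nsq_norm eq_complex /= eqxx andbT.
by [].
Qed.

Lemma nsq0 : nsq 0 = 0. Proof. by rewrite /nsq ip0l. Qed.

Lemma nsqZ a v : nsq (a *: v) = csq a * nsq v.
Proof. by rewrite /nsq ipZl ipZr mulrA -csqJ cReM_real. Qed.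

Lemma nsqN v : nsq (- v) = nsq v.
Proof. by rewrite /nsq ipNl ipNr opprK. Qed.

Lemma nsqD u v : nsq (u + v) = nsq u + nsq v + 2 * complex.Re (ip H u v).
Proof. rewrite /nsq ipDl !ipDr !cReD (ipC v u). by rewrite cRe_conj; ring. Qed.

Lemma nsqB u v : nsq (u - v) = nsq u + nsq v - 2 * complex.Re (ip H u v).
Proof. by rewrite nsqD nsqN ipNr cReN; ring. Qed.

Lemma nsqBC u v : nsq (u - v) = nsq (v - u).
Proof. by rewrite -nsqN opprB. Qed.

Lemma nsqD_orth u v : ip H u v = 0 -> nsq (u + v) = nsq u + nsq v.
Proof. by rewrite nsqD => ->; rewrite /= mulr0 addr0. Qed.

Lemma nsqD_le u v : nsq (u + v) <= 2 * nsq u + 2 * nsq v.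
Proof. by have := nsq_ge0 (u - v); rewrite nsqB nsqD; lra. Qed.

Lemma csq_ip_sym u v : csq (ip H u v) = csq (ip H v u).
Proof. by rewrite ipC csq_conj. Qed.

Lemma cauchy_schwarz u v : csq (ip H u v) <= nsq u * nsq v.
Proof.
have [->|v0] := eqVneq v 0; first by rewrite ip0r nsq0 mulr0 /csq /= expr0n addr0.
have nv : 0 < nsq v by rewrite lt_neqAle nsq_ge0 eq_sym nsq_eq0 v0.
have := nsq_ge0 (u - (ip H u v / (nsq v)%:C) *: v).
rewrite nsqB nsqZ ipZr.
have -> : ip H u v / (nsq v)%:C = ((nsq v)^-1)%:C * ip H u v.
  by rewrite mulrC fmorphV.
rewrite csqM csq_real conjcM conjc_real -(mulrA _%:C) cReM_real.
rewrite (mulrC (conjc _)) -csqJ /=.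
move=> h; have : 0 <= (nsq u + (nsq v)^-1 ^+ 2 * csq (ip H u v) * nsq v -
  2 * ((nsq v)^-1 * csq (ip H u v))) * nsq v by rewrite mulr_ge0// ltW.
rewrite -(subr_ge0 (csq _)); congr is_true; congr (0 <= _).
by field; apply: lt0r_neq0.
Qed.

Lemma ip_ext u v : (forall w, ip H u w = ip H v w) -> u = v.
Proof.
move=> h; apply/eqP; rewrite -subr_eq0 -nsq_eq0 /nsq ipBl h subrr.
by [].
Qed.

Lemma ip_extr u v : (forall w, ip H w u = ip H w v) -> u = v.
Proof. by move=> h; apply: ip_ext => w; rewrite ipC h -ipC. Qed.

Section Filter.
Context {T : Type} {F : set_system T} {FF : Filter F}.

Lemma hcvgP (f : T -> H) v :
  f t @[t --> F] --> v <-> (nsq (f t - v)) @[t --> F] --> (0 : R).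
Proof.
split.
  move=> /cvgrPdist_lt h; apply/cvgrPdist_lt => e e0; near=> t.
  rewrite sub0r normrN ger0_norm ?nsq_ge0//.
  have : `|v - f t| < (Num.sqrt e)%:C by near: t; apply: h; rewrite ltcR sqrtr_gt0.
  by rewrite norm_nsq ltcR ltr_sqrt// nsqBC.
move=> /cvgrPdist_lt h; apply/cvgrPdist_lt => e e0.
have e1 : e = (complex.Re e)%:C by apply: ge0_complex; exact: ltW.
have e2 : 0 < complex.Re e by move: e0; rewrite {1}e1 ltcR.
near=> t; rewrite e1 norm_nsq ltcR -(ger0_norm (ltW e2)) -sqrtr_sqr.
rewrite ltr_sqrt ?exprn_gt0//.
have : `|0 - nsq (f t - v)| < complex.Re e ^+ 2.
  by near: t; apply: h; rewrite exprn_gt0.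
by rewrite sub0r normrN ger0_norm ?nsq_ge0// nsqBC.
Unshelve. all: end_near. Qed.

Lemma squeeze0 (f g : T -> R) : (forall t, 0 <= f t <= g t) ->
  g t @[t --> F] --> (0 : R) -> f t @[t --> F] --> (0 : R).
Proof.
move=> fg g0; apply: (@squeeze_cvgr _ _ _ _ (cst 0) g) => //.
- by near=> t; exact: fg.
- exact: cvg_cst.
Unshelve. all: end_near. Qed.

Lemma hcvg_le (f : T -> H) v (g : T -> R) :
  (forall t, nsq (f t - v) <= g t) -> g t @[t --> F] --> (0 : R) ->
  f t @[t --> F] --> v.
Proof.
move=> fg g0; apply/hcvgP; apply: squeeze0 g0 => t.
by rewrite nsq_ge0 fg.
Qed.

Lemma csq_cvg (f : T -> R[i]) a : csq (f t - a) @[t --> F] --> (0 : R) ->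
  (f t : R[i]^o) @[t --> F] --> (a : R[i]^o).
Proof.
move=> /cvgrPdist_lt h.
have hn e : 0 < e -> \forall t \near F, csq (f t - a) < e ^+ 2.
  move=> e0; have := h (e ^+ 2); rewrite exprn_gt0// => /(_ isT).
  by apply: filterS => t; rewrite sub0r normrN ger0_norm ?csq_ge0.
have key (x e : R) : 0 < e -> x ^+ 2 < e ^+ 2 -> `|x| < e.
  move=> e0; rewrite -(real_normK (num_real x)) ltr_pXn2r// nnegrE.
  exact: ltW.
apply: cvg_Re_Im; apply/cvgrPdist_lt => e e0; near=> t; apply: key => //.
- apply: le_lt_trans (_ : csq (f t - a) < _); last by near: t; exact: hn.
  by rewrite (_ : _ - _ = - complex.Re (f t - a)) ?sqrrN ?cRe_sqr_le// cReD cReN opprB.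
- apply: le_lt_trans (_ : csq (f t - a) < _); last by near: t; exact: hn.
  rewrite (_ : _ - _ = - complex.Im (f t - a)) ?sqrrN; first by rewrite lerDr sqr_ge0.
  by case: (a) (f t) => ? ? [? ?] /=; rewrite opprB.
Unshelve. all: end_near. Qed.

Lemma ip_cvgl (f : T -> H) u v : f t @[t --> F] --> v ->
  (ip H (f t) u : R[i]^o) @[t --> F] --> (ip H v u : R[i]^o).
Proof.
move=> /hcvgP h; apply: csq_cvg.
apply: (@squeeze0 _ (fun t => nsq (f t - v) * nsq u)).
  by move=> t; rewrite csq_ge0 -ipBl cauchy_schwarz.
by rewrite -(mul0r (nsq u)); apply: cvgMl.
Qed.

Lemma ip_cvgr (f : T -> H) u v : f t @[t --> F] --> v ->
  (ip H u (f t) : R[i]^o) @[t --> F] --> (ip H u v : R[i]^o).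
Proof.
move=> /hcvgP h; apply: csq_cvg.
apply: (@squeeze0 _ (fun t => nsq u * nsq (f t - v))).
  by move=> t; rewrite csq_ge0 -ipBr cauchy_schwarz.
by rewrite -(mulr0 (nsq u)); apply: cvgMr.
Qed.

Lemma nsq_cvg (f : T -> H) v : f t @[t --> F] --> v ->
  nsq (f t) @[t --> F] --> nsq v.
Proof.
move=> fv; have h1 := (hcvgP _ _).1 fv.
have h2 : 2 * complex.Re (ip H (f t) v) @[t --> F] --> 2 * nsq v.
  by apply: cvgMr; apply: cvg_Re; apply: ip_cvgl.
have -> : nsq v = 0 - nsq v + 2 * nsq v by ring.
have -> : (fun t => nsq (f t)) =
    (fun t => nsq (f t - v) - nsq v + 2 * complex.Re (ip H (f t) v)).
  by apply/funext => t; rewrite nsqB; ring.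
by apply: cvgD => //; apply: cvgB => //; exact: cvg_cst.
Qed.

End Filter.

Lemma hcvg_unique (T : Type) (F : set_system T) {FF : ProperFilter F}
    (f : T -> H) u v :
  f t @[t --> F] --> u -> f t @[t --> F] --> v -> u = v.
Proof. by move=> h1 h2; apply: (cvg_unique _ h1 h2); exact: norm_hausdorff. Qed.

(* [a] is in practice the sequence of partial sums of a bounded series of
   nonnegative reals. *)
Lemma sq_cauchy_cvg (s : nat -> H) (a : nat -> R) (M : R) :
  (forall n, a n <= M) ->
  (forall m n, (m <= n)%N -> nsq (s n - s m) <= a n - a m) -> cvgn s.
Proof.
move=> aM sa.
have a_nd : nondecreasing_seq a.
  by move=> m n mn; rewrite -subr_ge0 (le_trans _ (sa m n mn))// nsq_ge0.
have ac : cvgn a by apply: nondecreasing_is_cvgn => //; exists M => _ [n _ <-].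
apply/cauchy_cvgP/cauchy_exP => e e0.
have e1 : e = (complex.Re e)%:C by apply: ge0_complex; exact: ltW.
have e2 : 0 < complex.Re e by move: e0; rewrite {1}e1 ltcR.
set d := complex.Re e in e1 e2.
have /cvgrPdist_lt /(_ (d ^+ 2 / 2)) : a @ \oo --> limn a by [].
rewrite divr_gt0 ?exprn_gt0// => /(_ isT) [N _ hN].
exists (s N); exists N => // n /= Nn; rewrite -ball_normE /ball_ /= e1 norm_nsq ltcR.
rewrite -(ger0_norm (ltW e2)) -sqrtr_sqr ltr_sqrt ?exprn_gt0// nsqBC.
apply: le_lt_trans (sa _ _ Nn) _.
have /= := hN N (leqnn N); have /= := hN n Nn.
rewrite !ltr_norml => /andP[? ?] /andP[? ?]; lra.
Qed.

End Hilbert.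

Section RealLimits.
Variable R : realType.

Lemma cvg_le_cst T (F : set_system T) {FF : ProperFilter F} (f : T -> R) l x :
  f t @[t --> F] --> l -> (forall t, f t <= x) -> l <= x.
Proof.
move=> fl fx; rewrite -(cvg_lim _ fl)//; apply: limr_le; first by apply/cvg_ex; exists l.
by apply: nearW.
Qed.

Lemma cvg_ge_cst T (F : set_system T) {FF : ProperFilter F} (f : T -> R) l x :
  f t @[t --> F] --> l -> (forall t, x <= f t) -> x <= l.
Proof.
move=> fl fx; rewrite -(cvg_lim _ fl)//; apply: limr_ge; first by apply/cvg_ex; exists l.
by apply: nearW.
Qed.

Lemma series_EFin (u : nat -> R) (l : R) : series u @ \oo --> l ->
  (\sum_(i <oo) (u i)%:E)%E = l%:E.
Proof.
move=> ul; apply: cvg_lim => //.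
rewrite (_ : (fun n => _) = (fun n => (series u n)%:E)).
  by apply: cvg_EFin => //; exact: nearW.
by apply/funext => n; rewrite /series /= sumEFin.
Qed.

Lemma ccvg_unique T (F : set_system T) {FF : ProperFilter F} (f : T -> R[i]) a b :
  (f t : R[i]^o) @[t --> F] --> (a : R[i]^o) ->
  (f t : R[i]^o) @[t --> F] --> (b : R[i]^o) -> b = a.
Proof.
move=> fa fb; exact: (cvg_unique (@norm_hausdorff _ (R[i]^o)) fb fa).
Qed.

End RealLimits.

(** * Bounded operators and their strong limits *)

Section Operators.
Variable R : realType.
Implicit Types H K L : hilbert R.

Lemma bop_linear H K (x : bop H K) : linear x.
Proof. by case: x => f fP; have [] := set_mem fP. Qed.

HB.instance Definition _ H K (x : bop H K) :=
  GRing.isLinear.Build _ _ _ _ (bop_fun x) (bop_linear x).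

Lemma bop_bound H K (x : bop H K) :
  exists2 M : R, 0 <= M & forall v, nsq (x v) <= M * nsq v.
Proof.
case: x => f fP; have /= [_ [M hM]] := set_mem fP.
exists (csq M) => [|v]; first exact: csq_ge0.
rewrite -lecR rmorphM /= !nsq_norm csqE -exprMn.
rewrite ler_pXn2r ?nnegrE ?mulr_ge0//.
rewrite (le_trans (hM v))// -[leLHS]ger0_norm ?normrM ?normr_id//.
exact: le_trans (hM v).
Qed.

Lemma bopP_nsq H K (f : H -> K) (M : R) : linear f ->
  (forall v, nsq (f v) <= M * nsq v) -> f \in bounded_operator H K.
Proof.
move=> lf hM; apply/mem_set; split=> //; exists (Num.sqrt (Num.max M 0))%:C => v.
have M0 : 0 <= Num.max M 0 by rewrite le_max lexx orbT.
rewrite !norm_nsq -rmorphM lecR -sqrtrM// ler_sqrt ?mulr_ge0 ?nsq_ge0//.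
by rewrite (le_trans (hM v))// ler_wpM2r ?nsq_ge0// le_max lexx.
Qed.

Lemma bop_ext H K (x y : bop H K) : (forall v, x v = y v) -> x = y.
Proof. by move=> h; apply: val_inj; apply/funext. Qed.

Lemma bopDE H K (x y : bop H K) v : (x + y) v = x v + y v.
Proof. by []. Qed.

Lemma bopBE H K (x y : bop H K) v : (x - y) v = x v - y v.
Proof. by []. Qed.

Lemma bopZE H K a (x : bop H K) v : (a *: x) v = a *: x v.
Proof. by []. Qed.

Lemma bop0E H K v : (0 : bop H K) v = 0.
Proof. by []. Qed.

Lemma bcompE H K L (x : bop K L) (y : bop H K) v : (x \oB y) v = x (y v).
Proof. by []. Qed.

Lemma bopDr H K (x : bop H K) u v : x (u + v) = x u + x v.
Proof. exact: linearD. Qed.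

Lemma bopBr H K (x : bop H K) u v : x (u - v) = x u - x v.
Proof. exact: linearB. Qed.

Lemma bopZr H K (x : bop H K) a v : x (a *: v) = a *: x v.
Proof. exact: linearZ. Qed.

Lemma bop0r H K (x : bop H K) : x 0 = 0.
Proof. exact: linear0. Qed.

Lemma bop_sumr H K (x : bop H K) I (r : seq I) (P : pred I) (F : I -> H) :
  x (\sum_(i <- r | P i) F i) = \sum_(i <- r | P i) x (F i).
Proof. exact: linear_sum. Qed.

Lemma bop_sumE H K I (r : seq I) (P : pred I) (F : I -> bop H K) v :
  (\sum_(i <- r | P i) F i) v = \sum_(i <- r | P i) F i v.
Proof. exact: (big_morph (fun x : bop H K => x v) (fun x y => bopDE x y v)). Qed.

Lemma bop_cvg H K (x : bop H K) T (F : set_system T) {FF : Filter F}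
    (f : T -> H) v : f t @[t --> F] --> v -> x (f t) @[t --> F] --> x v.
Proof.
have [M M0 hM] := bop_bound x; move=> /hcvgP h.
apply: (@hcvg_le _ _ _ _ _ _ _ (fun t => M * nsq (f t - v))).
  by move=> t; rewrite -linearB hM.
by rewrite -(mulr0 M); apply: cvgMr.
Qed.

Lemma lim_bop H K (z : nat -> bop H K) (M : R) :
  (forall n v, nsq (z n v) <= M * nsq v) -> (forall v, cvgn (fun n => z n v)) ->
  exists2 x : bop H K, forall v, z n v @[n --> \oo] --> x v &
    forall v, nsq (x v) <= M * nsq v.
Proof.
move=> hM hc; pose f v : K := limn (fun n => z n v).
have hf v : z n v @[n --> \oo] --> f v by exact: hc.
have lf : linear f.
  move=> a u v; apply: (hcvg_unique (hf (a *: u + v))).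
  rewrite (_ : (fun n => _) = (fun n => a *: z n u + z n v)); last first.
    by apply/funext => n; rewrite linearP.
  by apply: cvgD => //; apply: cvgZr.
have bf v : nsq (f v) <= M * nsq v.
  exact: (cvg_le_cst (nsq_cvg (hf v))).
by exists (Bop (bopP_nsq lf bf)).
Qed.

End Operators.

(** * Bessel's inequality, expansions and Parseval's identity *)

Section Basis.
Variables (R : realType) (H : hilbert R).

(* The zero vectors allowed in a basis are those that Gram-Schmidt produces from
   a dense sequence; they spare a reindexing. *)
Record hbasis (b : nat -> H) : Prop := HBasis {
  hb_orth : forall i j, i != j -> ip H (b i) (b j) = 0 ;
  hb_norm : forall i, b i = 0 \/ nsq (b i) = 1 ;
  hb_total : forall v, (forall i, ip H v (b i) = 0) -> v = 0 }.

Section Orthogonal.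
Variable x : nat -> H.
Hypothesis xo : forall i j, i != j -> ip H (x i) (x j) = 0.

Lemma orth_nsq m n : nsq (\sum_(m <= i < n) x i) = \sum_(m <= i < n) nsq (x i).
Proof.
elim: n => [|n IH]; first by rewrite !big_geq// nsq0.
have [mn|nm] := leqP m n; last by rewrite !big_geq// nsq0.
rewrite !big_nat_recr//= nsqD_orth ?IH//.
rewrite ip_suml big_nat_cond big1// => i /andP[/andP[_ ni] _].
by rewrite xo// ltn_eqF.
Qed.

Lemma orth_series_cvg (M : R) :
  (forall n, \sum_(0 <= i < n) nsq (x i) <= M) -> cvgn (series x).
Proof.
move=> hM; apply: (@sq_cauchy_cvg _ _ _ (series (fun i => nsq (x i))) M) => //.
by move=> m n mn; rewrite !sub_series_geq// orth_nsq.
Qed.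

End Orthogonal.

Variable b : nat -> H.
Hypothesis hb : hbasis b.

Lemma hb_nsqM i v : csq (ip H v (b i)) * nsq (b i) = csq (ip H v (b i)).
Proof.
have [->|->] := hb_norm hb i; last by rewrite mulr1.
by rewrite ip0r nsq0 mulr0 /csq /= expr0n addr0.
Qed.

Lemma hb_ortho_coef v i j : i != j ->
  ip H (ip H v (b i) *: b i) (ip H v (b j) *: b j) = 0.
Proof. by move=> ij; rewrite ipZl ipZr (hb_orth hb)// !mulr0. Qed.

Lemma nsq_psum v n : nsq (\sum_(0 <= i < n) ip H v (b i) *: b i) =
  \sum_(0 <= i < n) csq (ip H v (b i)).
Proof.
rewrite orth_nsq; last exact: hb_ortho_coef.
by apply: eq_bigr => i _; rewrite nsqZ hb_nsqM.
Qed.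

Lemma ip_psum v w n : ip H w (\sum_(0 <= i < n) ip H v (b i) *: b i) =
  \sum_(0 <= i < n) conjc (ip H v (b i)) * ip H w (b i).
Proof. by rewrite ip_sumr; apply: eq_bigr => i _; rewrite ipZr. Qed.

Lemma bessel v n : \sum_(0 <= i < n) csq (ip H v (b i)) <= nsq v.
Proof.
have := nsq_ge0 (v - \sum_(0 <= i < n) ip H v (b i) *: b i).
rewrite nsqB nsq_psum ip_psum.
under [in X in _ - 2 * X]eq_bigr do rewrite mulrC -csqJ.
by rewrite cRe_sum /=; lra.
Qed.

(** Bessel makes the series converge to some [l], and [v - l] is orthogonal to every [b i], hence
    zero by totality. *)
Lemma hb_expansion v : series (fun i => ip H v (b i) *: b i) @ \oo --> v.
Proof.
have /cvg_ex[/= l hl] : cvgn (series (fun i => ip H v (b i) *: b i)).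
  apply: (orth_series_cvg (@hb_ortho_coef v) (M := nsq v)) => n.
  by under eq_bigr do rewrite nsqZ hb_nsqM; exact: bessel.
suff vl : v = l by rewrite [X in _ --> X]vl.
apply/eqP; rewrite -subr_eq0; apply/eqP/(hb_total hb) => i.
rewrite ipBl; apply/eqP; rewrite subr_eq0; apply/eqP.
have h : (ip H (series (fun i => ip H v (b i) *: b i) n) (b i) : R[i]^o)
    @[n --> \oo] --> (ip H l (b i) : R[i]^o) by exact: ip_cvgl hl.
apply: ccvg_unique h _.
apply: cvg_near_cst; exists i.+1 => // n /= ni.
rewrite /series /= ip_suml (bigD1_seq i)/= ?iota_uniq//; last by rewrite mem_index_iota.
rewrite big1 ?addr0; last by move=> j ji; rewrite ipZl (hb_orth hb)// mulr0.
rewrite ipZl ipvv; have [->|->] := hb_norm hb i; last by rewrite mulr1.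
by rewrite ip0r mul0r.
Qed.

Lemma parseval v : series (fun i => csq (ip H v (b i))) @ \oo --> nsq v.
Proof.
have := nsq_cvg (@hb_expansion v) => /(_ _).
by under eq_fun do rewrite /series /= nsq_psum.
Qed.

Lemma parseval_ereal v :
  (\sum_(i <oo) (csq (ip H v (b i)))%:E)%E = (nsq v)%:E.
Proof.
exact: series_EFin (@parseval v).
Qed.

End Basis.

(** * Orthogonal bases and adjoints *)

Section GramSchmidt.
Variables (R : realType) (H : hilbert R).

Lemma dense_nsq (D : set H) : dense D -> forall v (e : R), 0 < e ->
  exists2 d, D d & nsq (d - v) < e.
Proof.
move=> dD v e e0.
have se : 0 < (Num.sqrt e)%:C :> R[i] by rewrite ltcR sqrtr_gt0.
have vo : nbhs v (ball v (Num.sqrt e)%:C) by exact: nbhsx_ballx.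
have [d [/interior_subset vd Dd]] : ((ball v (Num.sqrt e)%:C)^° `&` D) !=set0.
  apply: dD; last exact: open_interior.
  by exists v; apply: nbhs_singleton; exact: nbhs_interior.
exists d => //; move: vd; rewrite -ball_normE /ball_ /= norm_nsq ltcR.
by rewrite ltr_sqrt// nsqBC.
Qed.

(** For [y = 0] the convention that 0 has inverse 0 yields the zero vector, which [hbasis]
    allows. *)
Definition gs_next (s : seq H) (x : H) : H :=
  let y := x - \sum_(b <- s) ip H x b *: b in ((Num.sqrt (nsq y))^-1)%:C *: y.

Fixpoint gs_seq (d : nat -> H) (n : nat) : seq H :=
  if n is m.+1 then rcons (gs_seq d m) (gs_next (gs_seq d m) (d m)) else [::].

Definition gs (d : nat -> H) n := gs_next (gs_seq d n) (d n).

Lemma gs_seqE d n : gs_seq d n = [seq gs d i | i <- index_iota 0 n].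
Proof.
elim: n => // n IH; rewrite /index_iota subn0 -[in RHS]addn1 iotaD map_cat /=.
by rewrite cats1 IH /index_iota subn0 add0n /gs IH /index_iota subn0.
Qed.

Lemma gsE d n : gs d n =
  let y := d n - \sum_(0 <= i < n) ip H (d n) (gs d i) *: gs d i in
  ((Num.sqrt (nsq y))^-1)%:C *: y.
Proof. by rewrite {1}/gs /gs_next gs_seqE big_map. Qed.

Lemma gs_norm d n : gs d n = 0 \/ nsq (gs d n) = 1.
Proof.
rewrite gsE /=; set y := _ - _.
have [y0|y0] := eqVneq (nsq y) 0.
  by left; move/eqP: y0; rewrite nsq_eq0 => /eqP->; rewrite scaler0.
right; rewrite nsqZ csq_real exprVn sqr_sqrtr ?nsq_ge0// mulVf//.
Qed.

Lemma gs_orth_lt d n : forall i, (i < n)%N -> ip H (gs d n) (gs d i) = 0.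
Proof.
elim/ltn_ind: n => n IH i lin.
have orth j k : (j < n)%N -> (k < n)%N -> j != k -> ip H (gs d j) (gs d k) = 0.
  move=> jn kn; rewrite neq_ltn => /orP[jk|kj]; last exact: IH.
  by rewrite ipC (IH k)// conjc0.
rewrite (gsE d n) /= ipZl.
suff -> : ip H (d n - \sum_(0 <= i < n) ip H (d n) (gs d i) *: gs d i) (gs d i) = 0.
  by rewrite mulr0.
rewrite ipBl ip_suml (bigD1_seq i) ?iota_uniq//=; last first.
  by rewrite mem_index_iota.
rewrite big_seq_cond big1; last first.
  move=> j /andP[]; rewrite mem_index_iota => /andP[_ jn] ji.
  by rewrite ipZl orth// mulr0.
rewrite addr0 ipZl ipvv; have [->|->] := gs_norm d i.
  by rewrite ip0r mul0r subrr.
by rewrite mulr1 subrr.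
Qed.

Lemma gs_orth d i j : i != j -> ip H (gs d i) (gs d j) = 0.
Proof.
rewrite neq_ltn => /orP[ij|ji]; last exact: gs_orth_lt.
by rewrite ipC gs_orth_lt// conjc0.
Qed.

Lemma gs_total d v : (forall i, ip H v (gs d i) = 0) -> forall n, ip H v (d n) = 0.
Proof.
move=> h n; have := h n; rewrite gsE /=; set y := _ - _ => hy.
have -> : d n = y + \sum_(0 <= i < n) ip H (d n) (gs d i) *: gs d i.
  by rewrite /y subrK.
rewrite ipDr ip_sumr big1; last by move=> i _; rewrite ipZr h mulr0.
rewrite addr0; move: hy; rewrite ipZr conjc_real => /eqP; rewrite mulf_eq0.
case/orP => /eqP //.
have [y0|y0] := eqVneq (nsq y) 0; last first.
  move=> /eqP; rewrite eq_complex /= eqxx andbT invr_eq0 sqrtr_eq0.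
  by rewrite leNgt lt_neqAle nsq_ge0 eq_sym y0.
by move/eqP: y0; rewrite nsq_eq0 => /eqP->; rewrite ip0r.
Qed.

Lemma hbasis_exists : exists b : nat -> H, hbasis b.
Proof.
have [D cD dD] := hilbert_separable H.
have [p pinj] := elimT (countable_injP D) cD.
(* The injection [p] is inverted to list [D]; indices that it misses get the vector 0. *)
pose d n := xget 0 [set v | D v /\ p v = n].
exists (gs d); split; [exact: gs_orth|exact: gs_norm|].
move=> v /gs_total h.
have hD x : D x -> ip H v x = 0.
  move=> Dx; rewrite -(h (p x)) /d; case: xgetP => [y _ [Dy /pinj yx]|].
    by rewrite yx ?mem_set.
  by move=> /(_ x) [].
apply/eqP; rewrite -nsq_eq0; apply/eqP.
apply/eqP; rewrite eq_le nsq_ge0 andbT leNgt; apply/negP => v0.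
have [x Dx] := dense_nsq dD v v0.
rewrite nsqBC nsqB hD//= mulr0 subr0 gtrDl ltNge nsq_ge0//.
Qed.

Lemma unit_vector : exists v : H, nsq v = 1.
Proof.
have [b hb] := hbasis_exists; apply: contrapT => h.
case: (@hilbert_infinite_dim R H).
(* Without unit vectors all [b i] vanish, so totality makes [H] trivial and the empty family spans
   it. *)
exists 0%N, (fun _ => 0) => x; exists (fun _ => 0); rewrite big_ord0.
apply: (hb_total hb) => i; have [->|bi] := hb_norm hb i; first exact: ip0r.
by case: h; exists (b i).
Qed.

Lemma hbasis_unit (b : nat -> H) : hbasis b -> exists j, nsq (b j) = 1.
Proof.
move=> hb; have [v v1] := unit_vector; apply: contrapT => h.
have : v = 0.
  apply: (hb_total hb) => i; have [->|bi] := hb_norm hb i; first exact: ip0r.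
  by case: h; exists i.
by move=> v0; move: v1; rewrite v0 nsq0 => /eqP; rewrite eq_sym oner_eq0.
Qed.

End GramSchmidt.

Section Adjoint.
Variable R : realType.
Implicit Types H K L : hilbert R.

(** The value of the adjoint at w is built as the sum of the <w, x b_i> b_i. Its partial sums y_n
    satisfy |y_n|^2 = <x y_n, w>, so Cauchy-Schwarz gives |y_n|^2 <= M |w|^2. *)
Lemma adjoint_ip H K (x : bop H K) v w : ip K (x v) w = ip H v (adjoint x w).
Proof.
suff [y hy] : exists y : bop K H, forall v w, ip K (x v) w = ip H v (y w).
  by rewrite /adjoint; case: xgetP => [z _ ->//|/(_ y)].
have [b hb] := hbasis_exists H.
have [M M0 hM] := bop_bound x.
pose yn n w := \sum_(0 <= i < n) ip K w (x (b i)) *: b i.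
have yE n w' v' : ip H v' (yn n w') = ip K (x (\sum_(0 <= i < n) ip H v' (b i) *: b i)) w'.
  rewrite /yn ip_sumr linear_sum ip_suml; apply: eq_bigr => i _.
  by rewrite ipZr -ipC linearZ ipZl mulrC.
have yb n w' : nsq (yn n w') <= M * nsq w'.
  have e1 : yn n w' = \sum_(0 <= i < n) ip H (yn n w') (b i) *: b i.
    rewrite [LHS]/yn; apply: eq_big_nat => i ni; rewrite /yn ip_suml.
    rewrite (bigD1_seq i) ?iota_uniq ?mem_index_iota//= big1; last first.
      by move=> j ji; rewrite ipZl (hb_orth hb)// mulr0.
    rewrite addr0 ipZl ipvv; have [->|->] := hb_norm hb i; rewrite ?scaler0//.
    by rewrite mulr1.
  have := cauchy_schwarz (x (yn n w')) w'.
  rewrite {1}e1 -yE ipvv csq_real => h.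
  have [->|/eqP] := eqVneq (nsq (yn n w')) 0; first by rewrite mulr_ge0 ?nsq_ge0.
  move=> /eqP n0; have ngt : 0 < nsq (yn n w') by rewrite lt_neqAle eq_sym n0 nsq_ge0.
  rewrite -(ler_pM2l ngt) -expr2 (le_trans h)//.
  by rewrite mulrA ler_wpM2r ?nsq_ge0// mulrC.
have lyn n : linear (yn n).
  move=> a u w'; rewrite /yn scaler_sumr -big_split; apply: eq_bigr => i _ /=.
  by rewrite ipDl ipZl scalerDl scalerA.
pose z n : bop K H := Bop (bopP_nsq (lyn n) (yb n)).
have [|y hy _] := lim_bop (z := z) yb.
  move=> w'; apply: (@orth_series_cvg _ _ (fun i => ip K w' (x (b i)) *: b i) _ (M * nsq w')).
    by move=> i j ij; rewrite ipZl ipZr (hb_orth hb)// !mulr0.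
  move=> n; rewrite -orth_nsq; first exact: yb.
  by move=> i j ij; rewrite ipZl ipZr (hb_orth hb)// !mulr0.
exists y => v' w'.
have h1 : (ip H v' (z n w') : R[i]^o) @[n --> \oo] --> (ip H v' (y w') : R[i]^o).
  exact: ip_cvgr (hy w').
apply: ccvg_unique h1 _.
under eq_fun do rewrite /= yE.
apply: ip_cvgl; apply: bop_cvg; exact: hb_expansion.
Qed.

Lemma adjoint_ipr H K (x : bop H K) v w : ip H (adjoint x v) w = ip K v (x w).
Proof. by rewrite ipC -adjoint_ip -ipC. Qed.

Lemma adjoint_uniq H K (x : bop H K) (y : bop K H) :
  (forall v w, ip K (x v) w = ip H v (y w)) -> adjoint x = y.
Proof.
move=> h; apply: bop_ext => w; apply: ip_extr => v.
by rewrite -adjoint_ip h.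
Qed.

Lemma adjointK H K (x : bop H K) : adjoint (adjoint x) = x.
Proof. by apply: adjoint_uniq => v w; rewrite adjoint_ipr. Qed.

Lemma adjoint_comp H K L (x : bop K L) (y : bop H K) :
  adjoint (x \oB y) = adjoint y \oB adjoint x.
Proof. by apply: adjoint_uniq => v w /=; rewrite !adjoint_ip. Qed.

End Adjoint.

(** * The operator norm and the sigma-weak topology *)

Section OperatorNorm.
Variable R : realType.
Implicit Types H K : hilbert R.

Let S H K (x : bop H K) : set R :=
  [set complex.Re `|x v| | v in [set v : H | `|v| <= 1]].

Lemma norm_le1 H (v : H) : (`|v| <= 1) = (nsq v <= 1).
Proof.
by rewrite norm_nsq -(rmorph1 (real_complex R)) lecR -[X in _ <= X]sqrtr1 ler_sqrt.
Qed.

Lemma opnorm_has_sup H K (x : bop H K) : has_sup (S x).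
Proof.
split; first by exists (complex.Re `|x 0|), 0 => //=; rewrite normr0 ler01.
have [M M0 hM] := bop_bound x; exists (Num.sqrt M) => _ [v /= v1 <-].
rewrite norm_nsq /= ler_sqrt// (le_trans (hM v))// ler_piMr//.
by rewrite -norm_le1.
Qed.

Lemma opnorm_ge0 H K (x : bop H K) : 0 <= opnorm x.
Proof.
apply: ub_le_sup; first exact: (opnorm_has_sup x).2.
by exists 0; rewrite /= ?linear0 normr0// ler01.
Qed.

Lemma opnorm_bound H K (x : bop H K) v : nsq (x v) <= opnorm x ^+ 2 * nsq v.
Proof.
have [v0|v0] := eqVneq (nsq v) 0.
  by rewrite v0 mulr0; move/eqP: v0; rewrite nsq_eq0 => /eqP ->; rewrite linear0 nsq0.
have vp : 0 < nsq v by rewrite lt_neqAle eq_sym v0 nsq_ge0.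
pose c := (Num.sqrt (nsq v))^-1.
have c2 : c ^+ 2 * nsq v = 1 by rewrite exprVn sqr_sqrtr ?nsq_ge0// mulVf.
have : nsq (x (c%:C *: v)) <= opnorm x ^+ 2.
  rewrite -ler_sqrt ?exprn_ge0 ?opnorm_ge0// sqrtr_sqr ger0_norm ?opnorm_ge0//.
  apply: ub_le_sup; first exact: (opnorm_has_sup x).2.
  exists (c%:C *: v); last by rewrite norm_nsq.
  by rewrite /= norm_le1 nsqZ csq_real c2.
rewrite linearZ nsqZ csq_real => /(ler_wpM2r (nsq_ge0 v)).
by rewrite mulrAC c2 mul1r.
Qed.

Lemma opnorm_le H K (x : bop H K) M : 0 <= M ->
  (forall v, nsq (x v) <= M ^+ 2 * nsq v) -> opnorm x <= M.
Proof.
move=> M0 hM; apply: ge_sup; first exact: (opnorm_has_sup x).1.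
move=> _ [v /= + <-]; rewrite norm_le1 => v1.
rewrite norm_nsq /= -(ger0_norm M0) -sqrtr_sqr ler_sqrt ?exprn_ge0//.
by rewrite (le_trans (hM v))// ler_piMr ?exprn_ge0.
Qed.

End OperatorNorm.

Section SigmaWeak.
Variables (R : realType) (H : hilbert R).

Lemma square_summableP (xi : nat -> H) :
  square_summable xi <-> cvgn (series (fun n => nsq (xi n))).
Proof.
have E : (series (fun n => `|xi n| ^+ 2) : nat -> R[i]^o) =
         (fun n => (series (fun n => nsq (xi n)) n)%:C).
  apply/funext => n; rewrite /series /= rmorph_sum /=.
  by apply: eq_bigr => i _; rewrite nsq_norm.
rewrite /square_summable E; split => /cvg_ex[/= l hl]; apply/cvg_ex.
  by exists (complex.Re l); exact: (cvg_Re hl).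
exists (l%:C); apply: cvg_Re_Im => //=; exact: cvg_cst.
Qed.

Lemma series_tail (u g : nat -> R) : (forall n, `|u n| <= g n) ->
  cvgn (series g) -> cvgn (series u) /\
  forall N, `|limn (series u) - series u N| <= limn (series g) - series g N.
Proof.
move=> ug cg.
have g0 n : 0 <= g n by exact: le_trans (ug n).
have cu : cvgn (series u).
  apply: normed_cvg; apply: series_le_cvg cg => n //=.
split=> // N.
have h1 : `|series u n - series u N| @[n --> \oo] --> `|limn (series u) - series u N|.
  by apply: cvg_norm; apply: cvgB => //; exact: cvg_cst.
have h2 : series g n - series g N @[n --> \oo] --> limn (series g) - series g N.
  by apply: cvgB => //; exact: cvg_cst.
rewrite -(cvg_lim _ h1)// -(cvg_lim _ h2)//; apply: ler_lim.
- by apply/cvg_ex; eexists; exact: h1.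
- by apply/cvg_ex; eexists; exact: h2.
exists N => // n /= Nn; rewrite !sub_series_geq//.
by rewrite (le_trans (ler_norm_sum _ _ _))// ler_sum.
Qed.

(** Here [pt] stands for the real or the imaginary part, which reduces the estimate to real series
    dominated by |xi_n|^2 + |eta_n|^2. *)
Lemma sigma_weak_form_part (pt : R[i] -> R) :
  (forall a b, pt (a + b) = pt a + pt b) -> pt 0 = 0 ->
  (forall a, pt a ^+ 2 <= csq a) ->
  forall p : sigma_weak_index H, exists2 tau : nat -> R, tau @ \oo --> (0 : R) &
    forall (x : 'B(H)) (M : R), 0 <= M -> (forall v, nsq (x v) <= M ^+ 2 * nsq v) ->
    cvgn (series (fun n => pt (ip H (x ((sval p).1 n)) ((sval p).2 n)))) /\
    forall N, `|limn (series (fun n => pt (ip H (x ((sval p).1 n)) ((sval p).2 n))))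
      - series (fun n => pt (ip H (x ((sval p).1 n)) ((sval p).2 n))) N| <= M * tau N.
Proof.
move=> ptD pt0 ptb [[xi eta] /= [/square_summableP sx /square_summableP se]].
pose g n := nsq (xi n) + nsq (eta n).
have cg : cvgn (series g).
  rewrite (_ : series g = series (fun n => nsq (xi n)) + series (fun n => nsq (eta n))).
    exact: is_cvgD.
  by apply/funext => n; rewrite /series /= big_split.
exists (fun N => limn (series g) - series g N).
  by rewrite -(subrr (limn (series g))); apply: cvgB => //; exact: cvg_cst.
move=> x M M0 hM.
have ug n : `|pt (ip H (x (xi n)) (eta n))| <= M * g n.
  have gn : 0 <= M * g n by rewrite mulr_ge0// addr_ge0// nsq_ge0.
  rewrite -ler_sqr ?nnegrE// real_normK ?num_real// (le_trans (ptb _))//.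
  rewrite (le_trans (cauchy_schwarz _ _))//.
  rewrite (le_trans (ler_wpM2r (nsq_ge0 _) (hM _)))//.
  rewrite exprMn -mulrA ler_wpM2l ?exprn_ge0//.
  have := nsq_ge0 (xi n); have := nsq_ge0 (eta n); rewrite /g; nra.
have E : series (fun n => M * g n) = (fun n => M * series g n).
  by apply/funext => n; rewrite /series /= mulr_sumr.
have cMg : cvgn (series (fun n => M * g n)) by rewrite E; apply: is_cvgMr.
have [h1 h2] := series_tail ug cMg; split=> // N.
rewrite (le_trans (h2 N))// E mulrBr lerB//.
have : (fun n => M * series g n) @ \oo --> M * limn (series g) by apply: cvgMr.
by move=> /cvg_lim ->.
Qed.

(** The point is that [tau] does not depend on [x]: on a norm-bounded set the form is a uniform
    limit of finite sums of matrix coefficients, so that weak convergence there implies sigma-weak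
    convergence. *)
Lemma sigma_weak_form_tail (p : sigma_weak_index H) :
  exists2 tau : nat -> R, tau @ \oo --> (0 : R) &
    forall (x : 'B(H)) (M : R), 0 <= M -> (forall v, nsq (x v) <= M ^+ 2 * nsq v) ->
    forall N, csq (sigma_weak_form p x -
      series (fun n => ip H (x ((sval p).1 n)) ((sval p).2 n)) N) <= (M * tau N) ^+ 2.
Proof.
have [|//|//|t1 ht1 h1] := sigma_weak_form_part (pt := @complex.Re R) _ _ _ p.
- exact: cReD.
- exact: cRe_sqr_le.
have [|//|a|t2 ht2 h2] := sigma_weak_form_part (pt := @complex.Im R) _ _ _ p.
- exact: cImD.
- by rewrite /csq lerDr sqr_ge0.
exists (fun N => `|t1 N| + `|t2 N|).
  have -> : (0 : R) = `|0 : R| + `|0 : R| by rewrite normr0 addr0.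
  by apply: cvgD; apply: cvg_norm.
move=> x M M0 hM N.
have [c1 b1] := h1 x M M0 hM; have [c2 b2] := h2 x M M0 hM.
set s := series _; set l := sigma_weak_form p x.
set l1 := limn _ in c1 b1; set l2 := limn _ in c2 b2.
have e1 : series (fun n => complex.Re (ip H (x ((sval p).1 n)) ((sval p).2 n))) =
    (fun n => complex.Re (s n)) by apply/funext => n; rewrite /s /series /= cRe_sum.
have e2 : series (fun n => complex.Im (ip H (x ((sval p).1 n)) ((sval p).2 n))) =
    (fun n => complex.Im (s n)) by apply/funext => n; rewrite /s /series /= cIm_sum.
have -> : l = Complex l1 l2.
  apply: cvg_lim; first exact: norm_hausdorff.
  by apply: cvg_Re_Im => /=; [rewrite -e1|rewrite -e2].
move: (b1 N) (b2 N); rewrite e1 e2 => b1' b2'.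
have -> : csq (Complex l1 l2 - s N) =
    `|l1 - complex.Re (s N)| ^+ 2 + `|l2 - complex.Im (s N)| ^+ 2.
  by rewrite !real_normK ?num_real//; case: (s N) => ? ?.
have {}b1' := le_trans b1' (ler_wpM2l M0 (ler_norm (t1 N))).
have {}b2' := le_trans b2' (ler_wpM2l M0 (ler_norm (t2 N))).
have n1 := normr_ge0 (l1 - complex.Re (s N)).
have n2 := normr_ge0 (l2 - complex.Im (s N)).
rewrite mulrDr; nra.
Qed.

Lemma cvg_initial (S : choiceType) (T : topologicalType) (f : S -> T)
    (F : set_system S) {FF : Filter F} (s : S) :
  f x @[x --> F] --> f s -> F --> (s : initial_topology f).
Proof.
move=> h A; rewrite (@nbhsE (initial_topology f)) => -[B [[C oC <-] Cs] sBA].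
apply: filterS sBA _; apply: h; exact: open_nbhs_nbhs.
Qed.

Lemma sigma_weak_cvgP T (F : set_system T) {FF : Filter F} (f : T -> 'B(H)) (x : 'B(H)) :
  f @ F --> (x : sigma_weak_topology H) <->
  forall p, sigma_weak_form p (f t) @[t --> F] --> sigma_weak_form p x.
Proof.
split.
  move=> /cvg_sup h p; have {}h := h p.
  by apply: cvg_comp h _; exact: (@initial_continuous _ _ (sigma_weak_form p)).
by move=> h; apply/cvg_sup => p; apply: cvg_initial; exact: h.
Qed.

Lemma sigma_weak_cvg_bounded T (F : set_system T) {FF : Filter F}
    (f : T -> 'B(H)) (x : 'B(H)) (M : R) :
  (\forall t \near F, forall v, nsq (f t v) <= M ^+ 2 * nsq v) ->
  (forall v w, (ip H (f t v) w : R[i]^o) @[t --> F] --> (ip H (x v) w : R[i]^o)) ->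
  f @ F --> (x : sigma_weak_topology H).
Proof.
move=> fM fx; apply/sigma_weak_cvgP => p.
have [tau tau0 htau] := sigma_weak_form_tail p.
(* One bound for the family and its limit; the absolute value is there because [M] may be
   negative. *)
pose M' := maxr `|M| (opnorm x).
have M'0 : 0 <= M' by rewrite le_max normr_ge0.
have xM v : nsq (x v) <= M' ^+ 2 * nsq v.
  rewrite (le_trans (opnorm_bound x v))// ler_wpM2r ?nsq_ge0//.
  by rewrite ler_sqr ?nnegrE ?opnorm_ge0// le_max lexx orbT.
have fM' : \forall t \near F, forall v, nsq (f t v) <= M' ^+ 2 * nsq v.
  apply: filterS fM => t h v; rewrite (le_trans (h v))// ler_wpM2r ?nsq_ge0//.
  by rewrite -(real_normK (num_real M)) ler_sqr ?nnegrE// le_max lexx.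
apply: csq_cvg; apply/cvgrPdist_lt => e e0.
have : (M' * tau N) ^+ 2 @[N --> \oo] --> (M' * 0) ^+ 2.
  by apply: cvg_sqr; apply: cvgMr.
(* Three errors below e/12, weighted 2, 4, 4 by [csq_chain], add up to less than e. *)
rewrite mulr0 expr0n /= => /cvgrPdist_lt/(_ (e / 12)).
rewrite divr_gt0// => /(_ isT) [N _ /(_ N (leqnn N))] /=.
rewrite sub0r normrN ger0_norm ?sqr_ge0// => hN.
pose s y n : R[i] := series (fun n => ip H (y ((sval p).1 n)) ((sval p).2 n)) n.
have sc n : (s (f t) n : R[i]^o) @[t --> F] --> (s x n : R[i]^o).
  exact: (ccvg_sum (f := fun k t => ip H (f t ((sval p).1 k)) ((sval p).2 k))).
have /cvgrPdist_lt/(_ (e / 12)) : csq (s (f t) N - s x N) @[t --> F] --> (0 : R).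
  exact: cvg_csq (sc N).
rewrite divr_gt0// => /(_ isT) hs.
near=> t.
rewrite sub0r normrN ger0_norm ?csq_ge0//.
have hM : forall v, nsq (f t v) <= M' ^+ 2 * nsq v by near: t.
have := htau (f t) M' M'0 hM N; have := htau x M' M'0 xM N.
have t3 : csq (s (f t) N - s x N) < e / 12.
  have : `|0 - csq (s (f t) N - s x N)| < e / 12 by near: t.
  by rewrite sub0r normrN ger0_norm ?csq_ge0.
move=> t2 t1; apply: le_lt_trans (csq_chain _ (s (f t) N) (s x N) _) _.
apply: (@lt_le_trans _ _ (2 * (e / 12) + 4 * (e / 12) + 4 * (e / 12))); last by lra.
apply: ltrD; first apply: ltrD.
- by rewrite ltr_pM2l//; exact: le_lt_trans t1 hN.
- by rewrite ltr_pM2l.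
- by rewrite ltr_pM2l//; exact: le_lt_trans t2 hN.
Unshelve. all: end_near. Qed.

Lemma sigma_weak_cvg_ip T (F : set_system T) {FF : Filter F} (f : T -> 'B(H)) (x : 'B(H)) :
  f @ F --> (x : sigma_weak_topology H) ->
  forall v w, (ip H (f t v) w : R[i]^o) @[t --> F] --> (ip H (x v) w : R[i]^o).
Proof.
(* The sequences (v, 0, 0, ...) and (w, 0, 0, ...) reduce the form to the matrix coefficient <x v,
   w>. *)
move=> /sigma_weak_cvgP h v w.
pose xi (u : H) (n : nat) := if n is 0 then u else 0.
have sq u : square_summable (xi u).
  apply/square_summableP/cvg_ex; exists (nsq u); apply: cvg_near_cst.
  exists 1%N => // n /= n1; rewrite /series /= big_ltn// big_nat_cond big1 ?addr0//.
  by case=> //= i _; rewrite nsq0.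
pose p : sigma_weak_index H := exist _ (xi v, xi w) (conj (sq v) (sq w)).
have E (y : 'B(H)) : sigma_weak_form p y = ip H (y v) w.
  apply: cvg_lim; first exact: norm_hausdorff.
  apply: cvg_near_cst.
  exists 1%N => // n /= n1; rewrite /series /= big_ltn// big_nat_cond big1 ?addr0//.
  by case=> //= i _; rewrite ip0r.
by have := h p; rewrite E; under eq_fun do rewrite E.
Qed.

End SigmaWeak.

(** * Positive operators *)

Section Positive.
Variables (R : realType) (H : hilbert R).
Implicit Types (a b x y : 'B(H)) (v w : H).

Definition pos a : Prop := forall v, 0 <= ip H (a v) v.

Lemma pos_Re a v : pos a -> ip H (a v) v = (complex.Re (ip H (a v) v))%:C.
Proof. by move=> pa; apply: ge0_complex; exact: pa. Qed.

Lemma pos_Re_ge0 a v : pos a -> 0 <= complex.Re (ip H (a v) v).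
Proof. by move=> /(_ v); rewrite lecE /= => /andP[]. Qed.

(** Polarization: the form takes real values at [v + w] and at [v + i w], which forces symmetry. *)
Lemma pos_herm a v w : pos a -> ip H (a v) w = ip H v (a w).
Proof.
move=> pa.
have im0 u : complex.Im (ip H (a u) u) = 0 by apply: ger0_Im; exact: pa.
rewrite [RHS]ipC.
have h1 := im0 (v + w); have h2 := im0 (v + 'i%C *: w).
move: h1 h2; rewrite !bopDr !bopZr !ipDl !ipDr !ipZl !ipZr.
have := im0 v; have := im0 w.
case: (ip H (a v) v) (ip H (a w) w) (ip H (a v) w) (ip H (a w) v)
  => [? ?] [? ?] [? ?] [? ?] /= *.
by apply/eqP; rewrite eq_complex /=; apply/andP; split; apply/eqP; lra.
Qed.

Lemma posD a b : pos a -> pos b -> pos (a + b).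
Proof. by move=> pa pb v; rewrite bopDE ipDl addr_ge0. Qed.

Lemma pos1 : pos (bid H).
Proof. by move=> v /=; rewrite ipvv ler0c nsq_ge0. Qed.

Lemma posZ (c : R) a : 0 <= c -> pos a -> pos (c%:C *: a).
Proof. by move=> c0 pa v; rewrite bopZE ipZl mulr_ge0// ler0c. Qed.

(** This is a^2 <= a, from a - a^2 = a (1 - a) a + (1 - a) a (1 - a). *)
Lemma pos_nsq a v : pos a -> pos (bid H - a) ->
  nsq (a v) <= complex.Re (ip H (a v) v).
Proof.
move=> pa pb.
have := pos_Re_ge0 (a v) pb; have := pos_Re_ge0 (v - a v) pa.
rewrite bopBE /= bopBr !ipBl !ipBr !cReD !cReN !cReD !cReN.
rewrite (pos_herm (a v) v pa) -/(nsq _).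
have -> : complex.Re (ip H (a v) v) = complex.Re (ip H v (a v)).
  by rewrite (pos_herm _ _ pa).
by rewrite -/(nsq (a v)); lra.
Qed.

Lemma pos_le1 a v : pos (bid H - a) -> complex.Re (ip H (a v) v) <= nsq v.
Proof.
by move=> /(pos_Re_ge0 v); rewrite bopBE ipBl cReD cReN subr_ge0.
Qed.

Lemma pos_contract a v : pos a -> pos (bid H - a) -> nsq (a v) <= nsq v.
Proof. by move=> pa pb; exact: le_trans (pos_nsq v pa pb) (pos_le1 v pb). Qed.

Lemma pos_compl a : pos a -> pos (bid H - (bid H - a)).
Proof. by rewrite subKr. Qed.

(* [b_0 = b] and [b_(n+1) = b_n - b_n ^ 2] give [b = \sum_n b_n ^ 2] strongly,
   which replaces the square root of a positive contraction [b]. *)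
Fixpoint sqr_seq b n : 'B(H) :=
  if n is m.+1 then sqr_seq b m - sqr_seq b m \oB sqr_seq b m else b.

Section SqrSeq.
Variable b : 'B(H).
Hypotheses (pb : pos b) (pb1 : pos (bid H - b)).

Lemma sqr_seq_pos n : pos (sqr_seq b n) /\ pos (bid H - sqr_seq b n).
Proof.
elim: n => [//|n [p q]] /=; set c := sqr_seq b n in p q *.
have sq v : ip H ((c \oB c) v) v = (nsq (c v))%:C by rewrite /= pos_herm// ipvv.
split=> v.
  by rewrite bopBE ipBl sq (pos_Re _ p) -rmorphB ler0c subr_ge0 pos_nsq.
rewrite opprB addrA addrAC bopDE ipDl sq addr_ge0//; last by rewrite ler0c nsq_ge0.
Qed.

Lemma sqr_seq_comm y n : b \oB y = y \oB b -> sqr_seq b n \oB y = y \oB sqr_seq b n.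
Proof.
move=> cb; elim: n => [//|n IH] /=; set c := sqr_seq b n in IH *.
have IHe v : c (y v) = y (c v) by rewrite -[LHS]/((c \oB y) v) IH.
by apply: bop_ext => v; rewrite !(bcompE, bopBE) bopBr !IHe.
Qed.

Lemma sqr_seq_sum n : b = sqr_seq b n + \sum_(0 <= k < n) sqr_seq b k \oB sqr_seq b k.
Proof.
elim: n => [|n IH]; first by rewrite big_geq// addr0.
by rewrite big_nat_recr//= {1}IH addrACA addNr addr0 /=; congr (_ + _).
Qed.

(** By [sqr_seq_sum] the series of the |b_k v|^2 is bounded by <b v, v>, so its terms tend to 0. *)
Lemma sqr_seq_cvg0 v : sqr_seq b n v @[n --> \oo] --> (0 : H).
Proof.
apply/hcvgP; under eq_fun do rewrite subr0.
apply: cvg_series_cvg_0; apply: nondecreasing_is_cvgn.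
  apply: nondecreasing_series => n _ _; exact: nsq_ge0.
exists (complex.Re (ip H (b v) v)) => _ [n _ <-].
rewrite {2}(sqr_seq_sum n) bopDE ipDl cReD bop_sumE ip_suml cRe_sum /series /=.
rewrite [X in _ <= _ + X](eq_bigr (fun k => nsq (sqr_seq b k v))).
  by rewrite lerDr pos_Re_ge0//; exact: (sqr_seq_pos n).1.
by move=> k _ /=; rewrite pos_herm//; exact: (sqr_seq_pos k).1.
Qed.

End SqrSeq.

Lemma ccvg_ge0 (f : nat -> R[i]) l : (forall n, 0 <= f n) ->
  (f n : R[i]^o) @[n --> \oo] --> (l : R[i]^o) -> 0 <= l.
Proof.
move=> f0 fl; apply: complex_ge0.
  have h : complex.Im (f n) @[n --> \oo] --> complex.Im l by exact: cvg_Im fl.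
  rewrite -(cvg_lim _ h)//; apply: cvg_lim => //.
  by under eq_fun do rewrite ger0_Im//; exact: cvg_cst.
apply: (cvg_ge_cst (cvg_Re fl)) => n; have := f0 n.
by rewrite lecE /= => /andP[].
Qed.

(** With b the sum of the b_k^2 and every b_k commuting with the range of [phi], the map is a sum of
    the completely positive maps sending x to b_k phi(x) b_k. *)
Lemma cp_comm_pos (phi : 'B(H) -> 'B(H)) b : completely_positive phi ->
  pos b -> pos (bid H - b) -> (forall x, b \oB phi x = phi x \oB b) ->
  completely_positive (fun x => b \oB phi x).
Proof.
move=> [lphi cphi] pb pb1 bc; split.
  move=> c x y; apply: bop_ext => v.
  by rewrite !(bcompE, bopDE, bopZE) lphi !(bopDE, bopZE) bopDr bopZr.
move=> n a pa v.
pose S (c : 'B(H)) := \sum_(i < n) \sum_(j < n) ip H (c (phi (a i j) (v j))) (v i).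
have SE : \sum_(i < n) \sum_(j < n)
    ip H (map_mx (fun x => b \oB phi x) a i j (v j)) (v i) = S b.
  by apply: eq_bigr => i _; apply: eq_bigr => j _; rewrite mxE.
rewrite SE.
have SD c d : S (c + d) = S c + S d.
  rewrite /S -big_split; apply: eq_bigr => i _; rewrite -big_split.
  by apply: eq_bigr => j _; rewrite bopDE ipDl.
have Ssum N : S (\sum_(0 <= k < N) sqr_seq b k \oB sqr_seq b k) =
    \sum_(0 <= k < N) S (sqr_seq b k \oB sqr_seq b k).
  apply: (big_morph S SD); rewrite /S big1// => i _; rewrite big1// => j _.
  by rewrite bop0E ip0l.
have S0 : (S (sqr_seq b k) : R[i]^o) @[k --> \oo] --> (0 : R[i]^o).
  have : (S (sqr_seq b k) : R[i]^o) @[k --> \oo] -->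
      (\sum_(i < n) \sum_(j < n) ip H 0 (v i) : R[i]^o).
    rewrite /S; apply: ccvg_sum => i; apply: ccvg_sum => j.
    by apply: ip_cvgl; exact: sqr_seq_cvg0.
  under eq_bigr do (under eq_bigr do rewrite ip0l; rewrite sumr_const mul0rn).
  by rewrite sumr_const mul0rn.
have Spos k : 0 <= S (sqr_seq b k \oB sqr_seq b k).
  have [p q] := sqr_seq_pos pb pb1 k.
  have := cphi n a pa (fun i => sqr_seq b k (v i)).
  congr (0 <= _); apply: eq_bigr => i _; apply: eq_bigr => j _.
  rewrite mxE bcompE [RHS]pos_herm//; congr (ip H _ _).
  by rewrite -[LHS]bcompE -[RHS]bcompE sqr_seq_comm.
apply: (@ccvg_ge0 (fun N => S b - S (sqr_seq b N))).
  move=> N; rewrite {1}(sqr_seq_sum b N) SD addrC addKr Ssum.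
  by apply: sumr_ge0 => k _.
apply: csq_cvg.
rewrite (_ : (fun N => _) = (fun N => csq (S (sqr_seq b N) - 0))); first exact: cvg_csq S0.
by apply/funext => N; rewrite subr0 addrAC subrr add0r csqN.
Qed.

Lemma cp_pos (phi : 'B(H) -> 'B(H)) a : completely_positive phi -> pos a -> pos (phi a).
Proof.
move=> [_ cphi] pa v; have := cphi 1%N (const_mx a) _ (fun _ => v).
rewrite !big_ord1 !mxE; apply => w; rewrite !big_ord1 mxE; exact: pa.
Qed.

Lemma cp_linear (phi : 'B(H) -> 'B(H)) : completely_positive phi -> linear phi.
Proof. by case. Qed.

End Positive.

Lemma pos_conj (R : realType) (H K : hilbert R) (a : 'B(H)) (x : bop K H) :
  pos a -> pos (adjoint x \oB a \oB x).
Proof. by move=> pa v /=; rewrite adjoint_ipr. Qed.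

(** * Local cocycles and subordinates *)

Section LocalCocycles.
Variables (R : realType) (H : hilbert R) (alpha : R -> 'B(H) -> 'B(H)).
Hypothesis aE : E0_semigroup alpha.

Let aC := aE.1.

(** Positive contractive local cocycles: the data for which [A t \oB alpha t x] is a subordinate.
    The last clause is weak enough to be verified on a partial trace; [lc_continuous] recovers
    strong continuity from it. *)
Record local_cocycle (A : R -> 'B(H)) : Prop := LocalCocycle {
  lc_pos : forall t, 0 <= t -> pos (A t) ;
  lc_le1 : forall t, 0 <= t -> pos (bid H - A t) ;
  lc_comm : forall t x, 0 <= t -> A t \oB alpha t x = alpha t x \oB A t ;
  lc_add : forall s t, 0 <= s -> 0 <= t -> A (s + t) = A s \oB alpha s (A t) ;
  lc_cont0 : forall v, complex.Re (ip H (A t v) v) @[t --> 0^'+] --> nsq v }.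

Lemma alpha_bid t : 0 <= t -> alpha t (bid H) = bid H.
Proof. by move=> t0; have [_ ->] := aE.2 t t0. Qed.

Lemma alpha_lin t : 0 <= t -> linear (alpha t).
Proof. by move=> t0; exact: cp_linear (cps_cp aC t0). Qed.

Lemma alphaB t x y : 0 <= t -> alpha t (x - y) = alpha t x - alpha t y.
Proof.
move=> t0; have := alpha_lin t0 (-1) y x.
by rewrite !scaleN1r ![- _ + _]addrC.
Qed.

Lemma alpha_pos t a : 0 <= t -> pos a -> pos (alpha t a).
Proof. by move=> t0; apply: cp_pos; exact: cps_cp. Qed.

Lemma alpha_nsq t x v : 0 <= t -> nsq (alpha t x v) <= opnorm x ^+ 2 * nsq v.
Proof.
move=> t0; rewrite (le_trans (opnorm_bound _ _))// ler_wpM2r ?nsq_ge0//.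
by rewrite ler_sqr ?nnegrE ?opnorm_ge0//; exact: (cps_contraction aC t0).
Qed.

Lemma near_within_ge0 (t0 : R) : \forall t \near within `[0, +oo[ (nbhs t0), 0 <= t.
Proof. by rewrite near_withinE; apply: nearW => t; rewrite /= in_itv /= andbT. Qed.

Lemma alpha_wot (t0 : R) x v w : 0 <= t0 ->
  (ip H (alpha t x v) w : R[i]^o) @[t --> within `[0, +oo[ (nbhs t0)] -->
  (ip H (alpha t0 x v) w : R[i]^o).
Proof.
move=> t00; have h := (subspace_continuousP _ _).1 (@cps_continuous _ _ _ aC x) t0.
apply: (@sigma_weak_cvg_ip _ _ _ _ _ _ _ (h _) v w).
by rewrite /= in_itv /= t00.
Qed.

Section Cocycle.
Variable A : R -> 'B(H).
Hypothesis hA : local_cocycle A.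

(** By [pos_nsq] for 1 - A_t, |v - A_t v|^2 is at most |v|^2 - <A_t v, v>. *)
Lemma lc_near0 v : A t v @[t --> 0^'+] --> v.
Proof.
apply/hcvgP; apply: (@squeeze_cvgr _ _ _ _ (cst 0)
  (fun t => nsq v - complex.Re (ip H (A t v) v))).
- near=> t; rewrite nsq_ge0 /=; have t0 : 0 <= t by near: t; exact: nbhs_right_ge.
  rewrite nsqBC -[v - _]/((bid H - A t) v).
  rewrite (le_trans (pos_nsq v (lc_le1 hA t0) _))//.
    by apply: pos_compl; exact: lc_pos.
  by rewrite bopBE ipBl cReD cReN.
- exact: cvg_cst.
- rewrite -[X in _ --> X](subrr (nsq v)); apply: cvgB; [exact: cvg_cst|exact: lc_cont0 hA v].
Unshelve. all: end_near. Qed.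

(** As alpha_0 is the identity, A_t = A_0 A_t; let t tend to 0 on both sides. *)
Lemma lc_0 : A 0 = bid H.
Proof.
apply: bop_ext => v /=.
have h1 : A t v @[t --> 0^'+] --> A 0 v.
  have h : A 0 (A t v) @[t --> 0^'+] --> A 0 v by apply: bop_cvg; exact: lc_near0.
  apply: cvg_trans h; apply: near_eq_cvg; near=> t.
  have t0 : 0 <= t by near: t; exact: nbhs_right_ge.
  by rewrite -{2}(add0r t) (lc_add hA)// (cps_0 aC).
apply: hcvg_unique h1 _; exact: lc_near0.
Unshelve. all: end_near. Qed.

Lemma lc_cp t : 0 <= t -> completely_positive (fun x => A t \oB alpha t x).
Proof.
move=> t0; apply: cp_comm_pos; [exact: (cps_cp aC)|exact: lc_pos|exact: lc_le1|].
by move=> x; exact: lc_comm.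
Qed.

Lemma lc_cp_compl t : 0 <= t ->
  completely_positive (fun x => alpha t x - A t \oB alpha t x).
Proof.
move=> t0.
rewrite (_ : (fun x => _) = (fun x => (bid H - A t) \oB alpha t x)); last first.
  by apply/funext => x; apply: bop_ext => v.
apply: cp_comm_pos; [exact: (cps_cp aC)|exact: lc_le1|exact/pos_compl/lc_pos|].
move=> x; have h := lc_comm hA x t0; apply: bop_ext => v.
rewrite !(bcompE, bopBE) bopBr /=; congr (_ - _).
by rewrite -[LHS]bcompE h.
Qed.

Lemma lc_antimono s t : 0 <= s -> s <= t -> pos (A s - A t).
Proof.
move=> s0 st; have ts : 0 <= t - s by rewrite subr_ge0.
rewrite (_ : A s - A t = A s \oB alpha s (bid H - A (t - s))).
  by apply: (cp_pos (lc_cp s0)); exact: lc_le1.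
have {1}-> : A t = A s \oB alpha s (A (t - s)) by rewrite -(lc_add hA)// addrC subrK.
rewrite alphaB// alpha_bid//.
by apply: bop_ext => v; rewrite !(bcompE, bopBE) bopBr.
Qed.

(** The contractions 1 - A_s tend to 0 strongly, hence sigma-weakly, and the normal map alpha_t
    preserves this limit. *)
Lemma lc_alpha_near0 t v (e : R) : 0 <= t -> 0 < e ->
  exists2 s : R, 0 < s & complex.Re (ip H (alpha t (bid H - A s) v) v) < e.
Proof.
move=> t0 e0.
have h : (fun s => bid H - A s) @ 0^'+ --> (0 : sigma_weak_topology H).
  apply: (@sigma_weak_cvg_bounded _ _ _ _ _ _ _ 1).
    near=> s => w; rewrite expr1n mul1r.
    have s0 : 0 <= s by near: s; exact: nbhs_right_ge.
    by apply: pos_contract; [exact: lc_le1|exact/pos_compl/lc_pos].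
  move=> w u; apply: ip_cvgl; rewrite bop0E -[X in _ --> X](subrr w).
  apply: cvgB; [exact: cvg_cst|exact: lc_near0].
have h2 : (fun s => alpha t (bid H - A s)) @ 0^'+ --> (alpha t 0 : sigma_weak_topology H).
  by apply: cvg_comp h _; exact: (cps_normal aC t0).
have h3 : complex.Re (ip H (alpha t (bid H - A s) v) v) @[s --> 0^'+] -->
    complex.Re (ip H (alpha t 0 v) v).
  by apply: cvg_Re; exact: (@sigma_weak_cvg_ip _ _ _ _ _ _ _ h2 v v).
have z0 : alpha t 0 = 0 by have := alphaB 0 0 t0; rewrite !subrr.
move: h3; rewrite z0 bop0E ip0l => /cvgrPdist_lt/(_ e e0) h3.
near (0 : R)^'+ => s; exists s => //.
have : `|complex.Re 0 - complex.Re (ip H (alpha t (bid H - A s) v) v)| < e.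
  by near: s; exact: h3.
rewrite sub0r normrN; apply: le_lt_trans; exact: ler_norm.
Unshelve. all: end_near. Qed.

(** The increment A_r - A_(r+s) = A_r alpha_r(1 - A_s) is controlled for all s <= s0 by the single
    operator alpha_r(1 - A_s0). To the right of t0 one takes r = t0; to the left r = t moves, and
    weak continuity of alpha at t0 applies. *)
Lemma lc_continuous (t0 : R) v : 0 <= t0 ->
  A t v @[t --> within `[0, +oo[ (nbhs t0)] --> A t0 v.
Proof.
move=> t00; apply/hcvgP/cvgrPdist_lt => e e0.
have [s0 s00 hs] := lc_alpha_near0 v t00 e0.
have c1 : complex.Re (ip H (alpha t (bid H - A s0) v) v)
    @[t --> within `[0, +oo[ (nbhs t0)] -->
    complex.Re (ip H (alpha t0 (bid H - A s0) v) v).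
  by apply: cvg_Re; exact: alpha_wot.
have key r s : 0 <= r -> 0 <= s -> s <= s0 ->
    nsq (A r v - A (r + s) v) <= complex.Re (ip H (alpha r (bid H - A s0) v) v).
  move=> r0 s1 ss.
  have -> : A r v - A (r + s) v = A r (alpha r (bid H - A s) v).
    by rewrite (lc_add hA)// alphaB// alpha_bid// bopBE bopBr.
  rewrite (le_trans (pos_contract _ (lc_pos hA r0) (lc_le1 hA r0)))//.
  rewrite (le_trans (pos_nsq _ _ _))//.
  - by apply: alpha_pos => //; exact: lc_le1.
  - by rewrite -{1}(alpha_bid r0) -alphaB//; apply/alpha_pos => //; exact/pos_compl/lc_pos.
  rewrite -subr_ge0 -cReN -cReD -ipBl -bopBE -alphaB//.
  apply: pos_Re_ge0; apply: alpha_pos => //.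
  by rewrite opprB addrC addrA subrK; exact: lc_antimono.
near=> t.
have t1 : 0 <= t by near: t; exact: near_within_ge0.
rewrite sub0r normrN ger0_norm ?nsq_ge0//.
have dist : `|t0 - t| < s0.
  near: t; apply: cvg_within; apply: (@cvgr_dist_lt _ _ _ (nbhs t0) _ id t0) => //.
have [tt|tt] := leP t t0.
  have E : t0 = t + (t0 - t) by rewrite addrC subrK.
  rewrite {1}E (le_lt_trans (key t (t0 - t) _ _ _)) ?subr_ge0//.
    by move: dist; rewrite ger0_norm ?subr_ge0//; exact: ltW.
  by near: t; apply: (cvgr_lt _ c1).
have E : t = t0 + (t - t0) by rewrite addrC subrK.
rewrite nsqBC {1}E (le_lt_trans (key t0 (t - t0) _ _ _)) ?subr_ge0//; first exact: ltW.
by move: dist; rewrite distrC ger0_norm ?subr_ge0; [exact: ltW|exact: ltW].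
Unshelve. all: end_near. Qed.

End Cocycle.

End LocalCocycles.

Section Subordinates.
Variables (R : realType) (H : hilbert R) (alpha : R -> 'B(H) -> 'B(H)).
Hypothesis aE : E0_semigroup alpha.

Let aC := aE.1.

Section Cocycle.
Variable A : R -> 'B(H).
Hypothesis hA : local_cocycle alpha A.

Let beta (t : R) (x : 'B(H)) := A t \oB alpha t x.

Lemma lc_nsq t x v : 0 <= t -> nsq (beta t x v) <= opnorm x ^+ 2 * nsq v.
Proof.
move=> t0; rewrite (le_trans _ (alpha_nsq aE x v t0))//.
exact: (pos_contract _ (lc_pos hA t0) (lc_le1 hA t0)).
Qed.

Lemma lc_normal t : 0 <= t -> normal_map (beta t).
Proof.
move=> t0 x.
apply/(@sigma_weak_cvgP _ _ _ (nbhs (x : sigma_weak_topology H)) _ (beta t) (beta t x)).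
move=> -[[xi eta] /= [sx se]].
(* Moving the self-adjoint [A t] to the second argument turns a form of [beta t y] into a form of
   [alpha t y], whose vectors are still square-summable. *)
have sAe : square_summable (fun n => A t (eta n)).
  apply/square_summableP; apply: series_le_cvg ((square_summableP _).1 se).
  - by move=> n; exact: nsq_ge0.
  - by move=> n; exact: nsq_ge0.
  - by move=> n; exact: (pos_contract _ (lc_pos hA t0) (lc_le1 hA t0)).
pose q : sigma_weak_index H := exist _ (xi, fun n => A t (eta n)) (conj sx sAe).
have E y : sigma_weak_form (exist _ (xi, eta) (conj sx se) : sigma_weak_index H)
    (beta t y) = sigma_weak_form q (alpha t y).
  rewrite /sigma_weak_form /=; congr (limn (series _)); apply/funext => n.
  exact: pos_herm (lc_pos hA t0).
rewrite E; under eq_fun do rewrite E.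
exact: (@sigma_weak_cvgP _ _ _ (nbhs (x : sigma_weak_topology H)) _ (alpha t) _).1
  (@cps_normal _ _ _ aC t t0 x) q.
Qed.

Lemma lc_CP_semigroup : CP_semigroup beta.
Proof.
split.
- by move=> t t0; exact: lc_cp.
- exact: lc_normal.
- move=> t t0 x; apply: opnorm_le; first exact: opnorm_ge0.
  by move=> v; exact: lc_nsq.
- move=> x; rewrite /beta (lc_0 aE hA) (cps_0 aC); exact: bop_ext.
- move=> s t x s0 t0; rewrite /beta (lc_add hA)// (cps_add aC)//.
  have [[_ am _] _] := aE.2 s s0.
  by rewrite am; exact: bop_ext.
- move=> x; apply/subspace_continuousP => t0 /=; rewrite in_itv /= andbT => t00.
  apply: (@sigma_weak_cvg_bounded _ _ _ _ _ _ _ (opnorm x)).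
    near=> t => v; apply: lc_nsq; near: t; exact: near_within_ge0.
  move=> v w; apply: csq_cvg; rewrite /from_subspace.
  have c1 : csq (ip H (alpha t x v) (A t0 w) - ip H (alpha t0 x v) (A t0 w))
      @[t --> within `[0, +oo[ (nbhs (t0 : R))] --> (0 : R).
    by apply: cvg_csq; exact: alpha_wot.
  have /hcvgP c2 := @lc_continuous _ _ _ aE _ hA t0 w t00.
  (* [A t] is moved onto [w], where it converges strongly, while alpha_t(x) v stays bounded and
     converges weakly. *)
  apply: (@squeeze_cvgr _ _ _ _ (cst 0) (fun t =>
    2 * (opnorm x ^+ 2 * nsq v * nsq (A t w - A t0 w)) +
    2 * csq (ip H (alpha t x v) (A t0 w) - ip H (alpha t0 x v) (A t0 w)))).
  + near=> t; rewrite csq_ge0 /=.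
    have t1 : 0 <= t by near: t; exact: near_within_ge0.
    rewrite (pos_herm _ _ (lc_pos hA t1)) (pos_herm _ _ (lc_pos hA t00)).
    rewrite -(subrK (ip H (alpha t x v) (A t0 w)) (ip H (alpha t x v) (A t w))) -addrA.
    rewrite -ipBr (le_trans (csqD_le _ _))// lerD2r ler_pM2l//.
    rewrite (le_trans (cauchy_schwarz _ _))// ler_wpM2r ?nsq_ge0//.
    exact: alpha_nsq.
  + exact: cvg_cst.
  + rewrite [X in _ --> X](_ : _ = 2 * (opnorm x ^+ 2 * nsq v * 0) + 2 * 0);
      last by rewrite !mulr0 addr0.
    by apply: cvgD; apply: cvgMr => //; apply: cvgMr.
Unshelve. all: end_near. Qed.

Lemma lc_subordinate : subordinate beta alpha.
Proof.
split; [exact: lc_CP_semigroup|exact: aC|].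
by move=> t t0; exact: lc_cp_compl.
Qed.

End Cocycle.

Definition scale_cocycle (k : R) (A : R -> 'B(H)) (t : R) : 'B(H) :=
  (expR (k * t))%:C *: A t.

Lemma lc_scale A k : local_cocycle alpha A ->
  (forall t, 0 <= t -> pos (bid H - scale_cocycle k A t)) ->
  local_cocycle alpha (scale_cocycle k A).
Proof.
move=> hA h1; split => //.
- by move=> t t0; exact: (posZ (expR_ge0 _) (lc_pos hA t0)).
- move=> t x t0; have /(congr1 (fun y => (expR (k * t))%:C *: y)) := lc_comm hA x t0.
  by move=> h; apply: bop_ext => v; rewrite !(bcompE, bopZE) bopZr -!bcompE -!bopZE h.
- move=> s t s0 t0; rewrite /scale_cocycle mulrDr expRD (lc_add hA)//.
  have := alpha_lin aE s0 (expR (k * t))%:C (A t) 0.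
  have a0 : alpha s 0 = 0 by have := alphaB aE 0 0 s0; rewrite !subrr.
  rewrite a0 !addr0 => ->; apply: bop_ext => v.
  by rewrite !(bcompE, bopZE) bopZr scalerA rmorphM.
- move=> v; rewrite (_ : nsq v = expR (k * 0) * nsq v); last by rewrite mulr0 expR0 mul1r.
  under eq_fun do rewrite bopZE ipZl cReM_real.
  apply: cvgM; last exact: (@lc_cont0 _ _ _ _ hA v).
  apply: cvg_at_right_filter; apply: continuous_comp; last exact: continuous_expR.
  exact: mulrl_continuous.
Qed.

Lemma lc_nonzero A : local_cocycle alpha A ->
  exists t v, [/\ 0 < t, nsq v = 1 & 1 / 2 < complex.Re (ip H (A t v) v)].
Proof.
move=> hA; have [v v1] := unit_vector H.
have := @lc_cont0 _ _ _ _ hA v; rewrite v1 => /cvgrPdist_lt/(_ (1 / 2)).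
rewrite divr_gt0// => /(_ isT) h.
near (0 : R)^'+ => t; exists t, v; split=> //.
have : `|1 - complex.Re (ip H (A t v) v)| < 1 / 2 by near: t; exact: h.
by rewrite ltr_norml => /andP[_]; lra.
Unshelve. all: end_near. Qed.

Lemma scale_cocycle_le1 A k t : local_cocycle alpha A -> 0 <= t ->
  pos (bid H - scale_cocycle k A t) <->
  forall v, expR (k * t) * complex.Re (ip H (A t v) v) <= nsq v.
Proof.
move=> hA t0; split=> [h v|h v].
  by have := pos_le1 v h; rewrite bopZE ipZl cReM_real.
rewrite bopBE ipBl bopZE ipZl ipvv (pos_Re _ (lc_pos hA t0)) -rmorphM -rmorphB.
by rewrite ler0c subr_ge0.
Qed.

(** The rate is the supremum of those that keep the rescaled cocycle contractive. It is attained
    since contractivity is a closed condition, and a further rescaling that stayed subordinate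
    would, evaluated at the identity, exceed it. *)
Lemma lc_trivially_maximal A : local_cocycle alpha A ->
  exists2 k, 0 <= k & local_cocycle alpha (scale_cocycle k A) /\
    trivially_maximal (fun t x => scale_cocycle k A t \oB alpha t x) alpha.
Proof.
move=> hA.
pose K := [set k : R | 0 <= k /\ forall t, 0 <= t -> pos (bid H - scale_cocycle k A t)].
have K0 : K 0.
  split=> // t t0; apply/(scale_cocycle_le1 _ hA t0) => v.
  by rewrite mul0r expR0 mul1r; apply: pos_le1; apply: (lc_le1 hA).
have hK : has_sup K.
  split; first by exists 0.
  have [t [v [t0 v1 hv]]] := lc_nonzero hA.
  (* From e^(kt) / 2 <= 1 and 1 + kt <= e^(kt) one gets kt <= 1. *)
  exists (1 / t) => k [k0 hk].
  have := (scale_cocycle_le1 _ hA (ltW t0)).1 (hk t (ltW t0)) v.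
  rewrite v1 => h.
  have e1 := expR_ge1Dx (k * t); rewrite ler_pdivlMr//.
  have : 1 / 2 * expR (k * t) <= 1.
    by apply: le_trans h; rewrite mulrC ler_wpM2l ?expR_ge0// ltW.
  lra.
pose k0 := sup K.
have k00 : 0 <= k0 by apply: ub_le_sup => //; exact: hK.2.
have Kk0 t : 0 <= t -> pos (bid H - scale_cocycle k0 A t).
  rewrite le_eqVlt => /orP[/eqP<-|t0].
    apply/(scale_cocycle_le1 _ hA (lexx 0)) => v.
    by rewrite mulr0 expR0 mul1r; apply: pos_le1; apply: (lc_le1 hA).
  apply/(scale_cocycle_le1 _ hA (ltW t0)) => v; set q := complex.Re _.
  have q0 : 0 <= q by exact: (pos_Re_ge0 _ (lc_pos hA (ltW t0))).
  rewrite leNgt; apply/negP; set c := _ * q => cn.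
  have n0 := nsq_ge0 v.
  have c0 : 0 < c by exact: le_lt_trans cn.
  (* Chosen so that c (1 - eps t) is the midpoint of c and |v|^2; since e^(-x) >= 1 - x, a rate
     above [k0 - eps] already violates contractivity at v. *)
  pose eps := (c - nsq v) / (2 * c * t).
  have e0 : 0 < eps by apply: divr_gt0; [rewrite subr_gt0|apply: mulr_gt0 => //; exact: mulr_gt0].
  have [k [kp hk] kk] := sup_adherent e0 hK.
  have := (scale_cocycle_le1 _ hA (ltW t0)).1 (hk t (ltW t0)) v; rewrite -/q.
  apply/negP; rewrite -ltNge.
  have h1 : expR ((k0 - eps) * t) <= expR (k * t).
    by rewrite ler_expR ler_wpM2r// ltW.
  apply: lt_le_trans (ler_wpM2r q0 h1).
  have -> : (k0 - eps) * t = k0 * t + - (eps * t) by ring.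
  rewrite expRD mulrAC -/c.
  have h2 := expR_ge1Dx (- (eps * t)).
  apply: lt_le_trans (ler_wpM2l (ltW c0) h2).
  have -> : c * (1 + - (eps * t)) = c - (c - nsq v) / 2.
    by rewrite /eps; field; rewrite !lt0r_neq0.
  by lra.
have hA' := lc_scale hA Kk0.
exists k0 => //; split=> //; split; first exact: lc_subordinate.
move=> k kp [_ _ hs].
suff : K (k + k0).
  move=> hKk; have := ub_le_sup hK.2 hKk; rewrite -/k0; lra.
split=> [|t t0]; first by rewrite addr_ge0// ltW.
have := cp_pos (hs t t0) (@pos1 _ H); rewrite alpha_bid//.
congr pos; congr (_ - _); apply: bop_ext => v.
by rewrite !(bopZE, bcompE) /= scalerA -rmorphM -expRD -mulrDl.
Qed.

Lemma subordinate_lc A B t : 0 <= t ->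
  subordinate (fun t x => A t \oB alpha t x) (fun t x => B t \oB alpha t x) ->
  pos (B t - A t).
Proof.
move=> t0 [_ _ /(_ t t0)] /cp_pos /(_ (@pos1 _ H)); rewrite (alpha_bid aE t0) => h v; exact: h.
Qed.

End Subordinates.

(** * Tensor products *)

Section Flip.
Variables (R : realType) (H1 H2 K : hilbert R) (tens : {bilinear H1 -> H2 -> K}).

(** Allows every construction on the first factor to be repeated on the second. *)
Definition tflip (w : H2) (v : H1) : K := tens v w.

Lemma tflip_bilinear : bilinear_for *:%R *:%R tflip.
Proof.
split=> [v a u w|w a u v]; rewrite /tflip.
  by rewrite /= linearPr.
by rewrite /= linearPl.
Qed.

HB.instance Definition _ :=
  bilinear_isBilinear.Build R[i] H2 H1 K *:%R *:%R tflip tflip_bilinear.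

Lemma tflip_product : is_tensor_product tens -> is_tensor_product tflip.
Proof.
move=> [hip hd]; split=> [v v' w w'|]; first by rewrite hip mulrC.
rewrite (_ : [set z | _] = [set z : K | exists n (v : 'I_n -> H1) (w : 'I_n -> H2),
  z = \sum_(i < n) tens (v i) (w i)])//.
by apply/seteqP; split=> z [n [v [w zE]]]; exists n, w, v.
Qed.

Lemma tflip_semigroup beta gamma delta : is_tensor_semigroup tens beta gamma delta ->
  is_tensor_semigroup tflip gamma beta delta.
Proof.
move=> [dE h]; split=> // t x y z t0 hz v w.
by rewrite /= /tflip (h t y x z)// => v' w'; exact: hz.
Qed.

End Flip.

Section RankOne.
Variables (R : realType) (H K : hilbert R).

Lemma rank1_subproof (u : K) (w : H) :
  (fun v : H => ip H v w *: u) \in bounded_operator H K.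
Proof.
apply: (@bopP_nsq _ _ _ _ (nsq u * nsq w)).
  by move=> a x y; rewrite ipDl ipZl scalerDl scalerA.
move=> v; rewrite nsqZ -mulrA (mulrC _ (nsq u)) ler_wpM2l ?nsq_ge0//.
by rewrite mulrC cauchy_schwarz.
Qed.

Definition rank1 (u : K) (w : H) : bop H K := Bop (rank1_subproof u w).

Lemma rank1E u w v : rank1 u w v = ip H v w *: u.
Proof. by []. Qed.

End RankOne.

Section Tensor.
Variables (R : realType) (H1 H2 K : hilbert R) (tens : {bilinear H1 -> H2 -> K}).
Hypothesis ht : is_tensor_product tens.

Lemma tens_ip v v' w w' : ip K (tens v w) (tens v' w') = ip H1 v v' * ip H2 w w'.
Proof. exact: ht.1. Qed.

Lemma tens_nsq v w : nsq (tens v w) = nsq v * nsq w.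
Proof. by rewrite {1}/nsq tens_ip !ipvv -rmorphM. Qed.

Lemma tensl_subproof v : (fun w => tens v w) \in bounded_operator H2 K.
Proof.
apply: (@bopP_nsq _ _ _ _ (nsq v)); first by move=> a x y; rewrite linearPr.
by move=> w; rewrite tens_nsq.
Qed.

Lemma tensr_subproof w : (fun v => tens v w) \in bounded_operator H1 K.
Proof.
apply: (@bopP_nsq _ _ _ _ (nsq w)); first by move=> a x y; rewrite linearPl.
by move=> v; rewrite tens_nsq mulrC.
Qed.

Definition tensl v : bop H2 K := Bop (tensl_subproof v).
Definition tensr w : bop H1 K := Bop (tensr_subproof w).

Lemma tens_total z : (forall v w, ip K z (tens v w) = 0) -> z = 0.
Proof.
move=> h; apply/eqP; rewrite -nsq_eq0; apply/eqP.
apply/eqP; rewrite eq_le nsq_ge0 andbT leNgt; apply/negP => z0.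
have [x [n [v [w xE]]]] := dense_nsq ht.2 z z0.
have zx : ip K z x = 0 by rewrite xE ip_sumr big1.
by rewrite nsqBC nsqB zx mulr0 subr0 gtrDl ltNge nsq_ge0.
Qed.

Lemma tens_ext (L : hilbert R) (x y : bop K L) :
  (forall v w, x (tens v w) = y (tens v w)) -> x = y.
Proof.
move=> h; apply: bop_ext => z; apply: ip_ext => l.
suff E : adjoint x l = adjoint y l by rewrite !adjoint_ip E.
apply/eqP; rewrite -subr_eq0; apply/eqP/tens_total => v w.
by rewrite ipBl !adjoint_ipr h subrr.
Qed.

Lemma adjoint_tensr w w' v : adjoint (tensr w') (tensr w v) = ip H2 w w' *: v.
Proof. by apply: ip_ext => u; rewrite adjoint_ipr tens_ip ipZl mulrC. Qed.

Section Amplification.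
Variable g : nat -> H2.
Hypothesis hg : hbasis g.

Let J k := tensr (g k).

Lemma amp_orth (y : nat -> H1) i j : i != j -> ip K (J i (y i)) (J j (y j)) = 0.
Proof. by move=> ij; rewrite tens_ip (hb_orth hg)// mulr0. Qed.

Lemma amp_nsq_le k v : nsq (J k v) <= nsq v.
Proof.
rewrite tens_nsq; have [->|->] := hb_norm hg k; rewrite ?mulr1//.
by rewrite nsq0 mulr0 nsq_ge0.
Qed.

Lemma amp_nsq k z : nsq (J k (adjoint (J k) z)) = nsq (adjoint (J k) z).
Proof.
rewrite tens_nsq; have [g0|->] := hb_norm hg k; last by rewrite mulr1.
suff -> : adjoint (J k) z = 0 by rewrite nsq0 mul0r.
by apply: ip_ext => u; rewrite adjoint_ipr ip0l /J /= g0 linear0r ip0r.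
Qed.

Lemma amp_bessel z n : \sum_(0 <= k < n) nsq (adjoint (J k) z) <= nsq z.
Proof.
have := nsq_ge0 (z - \sum_(0 <= k < n) J k (adjoint (J k) z)).
rewrite nsqB (orth_nsq (x := fun k => J k (adjoint (J k) z))); last exact: amp_orth.
under eq_bigr do rewrite amp_nsq.
rewrite ip_sumr cRe_sum.
under [X in _ - 2 * X]eq_bigr do rewrite -adjoint_ipr -/(nsq _).
lra.
Qed.

(** As [tens] is given on vectors only, x (x) 1 has to be constructed: it is the strong sum of the
    J_k x J_k^*, where the J_k are isometries, or 0, with mutually orthogonal ranges. *)
Lemma amplification_subproof (x : 'B(H1)) : exists2 y : 'B(K),
  is_tensor_operator tens x (bid H2) y &
  forall z, series (fun k => J k (x (adjoint (J k) z))) @ \oo --> y z.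
Proof.
have [M M0 hM] := bop_bound x.
pose zn n : 'B(K) := \sum_(0 <= k < n) J k \oB x \oB adjoint (J k).
have znE n z : zn n z = \sum_(0 <= k < n) J k (x (adjoint (J k) z)).
  exact: bop_sumE.
have sumM z n : \sum_(0 <= k < n) nsq (J k (x (adjoint (J k) z))) <= M * nsq z.
  apply: (@le_trans _ _ (\sum_(0 <= k < n) M * nsq (adjoint (J k) z))).
    apply: ler_sum => k _; apply: le_trans (amp_nsq_le _ _) (hM _).
  by rewrite -mulr_sumr ler_wpM2l// amp_bessel.
have [||y hy _] := @lim_bop _ _ _ zn M.
- move=> n z; rewrite znE (orth_nsq (x := fun k => J k (x (adjoint (J k) z)))).
    exact: sumM.
  exact: amp_orth.
- move=> z; under eq_fun do rewrite znE.
  apply: (orth_series_cvg (x := fun k => J k (x (adjoint (J k) z)))); last exact: sumM.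
  exact: amp_orth.
have hy' z : series (fun k => J k (x (adjoint (J k) z))) @ \oo --> y z.
  by have := hy z; under eq_fun do rewrite znE.
exists y => // v w; apply: hcvg_unique (hy' _) _.
have E n : \sum_(0 <= k < n) J k (x (adjoint (J k) (tens v w))) =
    tensl (x v) (series (fun i => ip H2 w (g i) *: g i) n).
  rewrite bop_sumr; apply: eq_bigr => k _.
  by rewrite adjoint_tensr bopZr /J /= linearZl_LR linearZr_LR.
under eq_fun do rewrite E.
apply: (bop_cvg (x := tensl (x v))); exact: hb_expansion.
Qed.

Lemma tens_expansion z : series (fun k => J k (adjoint (J k) z)) @ \oo --> z.
Proof.
have [y hy cy] := amplification_subproof (bid H1).
have zy : z = y z.
  by rewrite -[LHS]/(bid K z); congr (bop_fun _ z); apply: tens_ext => v w; rewrite hy.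
by rewrite [X in _ --> X]zy; exact: cy.
Qed.

End Amplification.

Lemma amplification (x : 'B(H1)) : exists y : 'B(K), is_tensor_operator tens x (bid H2) y.
Proof.
have [g hg] := hbasis_exists H2.
by have [y] := amplification_subproof hg x; exists y.
Qed.

Section ProductBasis.
Variables (e : nat -> H1) (g : nat -> H2).
Hypotheses (he : hbasis e) (hg : hbasis g).

(** Integers that encode no pair give the zero vector, which [hbasis] allows; [pickle_inv] succeeds
    on genuine codes only, so no pair is listed twice. *)
Definition tbasis (m : nat) : K :=
  if @pickle_inv (nat * nat)%type m is Some ij then tens (e ij.1) (g ij.2) else 0.

Lemma tbasis_pair i j : exists m, tbasis m = tens (e i) (g j).
Proof. by exists (pickle (i, j)); rewrite /tbasis pickleK_inv. Qed.

Lemma hbasis_tens : hbasis tbasis.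
Proof.
split.
- move=> m n mn; rewrite /tbasis.
  have := @pickle_invK (nat * nat)%type m; have := @pickle_invK (nat * nat)%type n.
  case: (pickle_inv m) => [[i j]|]; last by rewrite ip0l.
  case: (pickle_inv n) => [[i' j']|] /=; last by rewrite ip0r.
  move=> hn hm; rewrite tens_ip.
  have [ii|ii] := eqVneq i i'; last by rewrite (hb_orth he)// mul0r.
  have [jj|jj] := eqVneq j j'; last by rewrite (hb_orth hg)// mulr0.
  by move: mn; rewrite -hn -hm ii jj eqxx.
- move=> m; rewrite /tbasis; case: (pickle_inv m) => [[i j]|]; last by left.
  rewrite tens_nsq /=; have [->|->] := hb_norm he i; first by left; rewrite linear0l.
  have [->|->] := hb_norm hg j; first by left; rewrite linear0r.
  by right; rewrite mulr1.
- move=> z hz; apply: tens_total => v w.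
  rewrite -[tens v w]/(tensr w v) -adjoint_ipr.
  suff -> : adjoint (tensr w) z = 0 by rewrite ip0l.
  apply: (hb_total he) => i; rewrite adjoint_ipr.
  rewrite -[tensr w _]/(tensl (e i) w) -adjoint_ipr.
  suff -> : adjoint (tensl (e i)) z = 0 by rewrite ip0l.
  apply: (hb_total hg) => j; rewrite adjoint_ipr.
  by have [m mE] := tbasis_pair i j; rewrite -[tensl _ _]mE.
Qed.

Lemma tensor_rank1 m n : exists x y, is_tensor_operator tens x y (rank1 (tbasis m) (tbasis n)).
Proof.
rewrite /tbasis; case: (pickle_inv m) => [[i j]|]; last first.
  by exists 0, 0 => v w; rewrite rank1E scaler0 !bop0E linear0l.
case: (pickle_inv n) => [[i' j']|]; last first.
  by exists 0, 0 => v w; rewrite rank1E ip0r scale0r !bop0E linear0l.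
exists (rank1 (e i) (e i')), (rank1 (g j) (g j')) => v w.
by rewrite !rank1E tens_ip linearZl_LR linearZr_LR /= scalerA.
Qed.

End ProductBasis.

End Tensor.

Section FiniteRankDensity.
Variables (R : realType) (K : hilbert R) (b : nat -> K).
Hypothesis hb : hbasis b.

(** This is P_n z P_n for the projection P_n onto the first n basis vectors, expanded into rank-one
    operators because these are elementary tensors for a product basis. *)
Definition compress n (z : 'B(K)) : 'B(K) :=
  \sum_(0 <= i < n) \sum_(0 <= j < n) ip K (z (b j)) (b i) *: rank1 (b i) (b j).

Let P n v := \sum_(0 <= i < n) ip K v (b i) *: b i.

Lemma compressE n z v : compress n z v = P n (z (P n v)).
Proof.
rewrite /compress /P bop_sumE; apply: eq_bigr => i _.
rewrite bop_sumE bop_sumr ip_suml scaler_suml; apply: eq_bigr => j _.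
by rewrite bopZE rank1E bopZr ipZl scalerA mulrC.
Qed.

Lemma compress_cvg z : (fun n => compress n z) @ \oo --> (z : sigma_weak_topology K).
Proof.
have Pn n v : nsq (P n v) <= nsq v by rewrite nsq_psum// bessel.
apply: (@sigma_weak_cvg_bounded _ _ _ _ _ _ _ (opnorm z)).
  apply: nearW => n v; rewrite compressE (le_trans (Pn _ _))//.
  by rewrite (le_trans (opnorm_bound _ _))// ler_wpM2l ?exprn_ge0 ?opnorm_ge0.
move=> v w; apply: ip_cvgl.
have Pc u : P n u @[n --> \oo] --> u by exact: hb_expansion.
have c1 : nsq (z (P n v) - z v) @[n --> \oo] --> (0 : R).
  by apply/hcvgP; apply: bop_cvg.
have /hcvgP c2 := Pc (z v).
apply: (@hcvg_le _ _ _ _ _ _ _ (fun n => 2 * nsq (z (P n v) - z v) +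
  2 * nsq (P n (z v) - z v))).
  move=> n; rewrite compressE.
  have -> : P n (z (P n v)) - z v = P n (z (P n v) - z v) + (P n (z v) - z v).
    rewrite addrA; congr (_ - _); rewrite /P -big_split; apply: eq_bigr => i _ /=.
    by rewrite -scalerDl -ipDl subrK.
  by rewrite (le_trans (nsqD_le _ _))// lerD2r ler_pM2l.
rewrite [X in _ --> X](_ : _ = 2 * 0 + 2 * 0); last by rewrite !mulr0 addr0.
by apply: cvgD; apply: cvgMr.
Qed.

End FiniteRankDensity.

Section TensorCommutant.
Variables (R : realType) (H1 H2 K : hilbert R) (tens : {bilinear H1 -> H2 -> K}).
Hypothesis ht : is_tensor_product tens.

(** The compressions of [z] are combinations of elementary tensors and tend to [z] sigma-weakly, a
    limit that the normal map [phi] preserves. *)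
Lemma commute_normal (phi : 'B(K) -> 'B(K)) (a : 'B(K)) :
  linear phi -> normal_map phi ->
  (forall x y z, is_tensor_operator tens x y z -> a \oB phi z = phi z \oB a) ->
  forall z, a \oB phi z = phi z \oB a.
Proof.
move=> lphi nphi ha z.
have [e he] := hbasis_exists H1; have [g hg] := hbasis_exists H2.
have hb := hbasis_tens ht he hg; set b := tbasis _ _ _ in hb.
have ha' y : a \oB phi y = phi y \oB a -> forall v, a (phi y v) = phi y (a v).
  by move=> h v; rewrite -bcompE h.
have phi0 : phi 0 = 0.
  by have := lphi (-1) 0 0; rewrite scaler0 addr0 scaleN1r addNr.
have comm n : a \oB phi (compress b n z) = phi (compress b n z) \oB a.
  pose C (y : 'B(K)) := a \oB phi y = phi y \oB a.
  have C0 : C 0 by apply: bop_ext => v; rewrite phi0 !bcompE !bop0E bop0r.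
  have CP c x y : C x -> C y -> C (c *: x + y).
    move=> hx hy; apply: bop_ext => v; rewrite !bcompE lphi !(bopDE, bopZE).
    by rewrite bopDr bopZr !ha'.
  have CD x y : C x -> C y -> C (x + y).
    by move=> hx hy; rewrite -(scale1r x); exact: CP.
  apply: (big_ind C) => // i _; apply: (big_ind C) => // j _.
  rewrite -[X in C X]addr0; apply: CP => //.
  have [x [y hxy]] := tensor_rank1 ht e g i j; exact: ha hxy.
have h : (fun n => phi (compress b n z)) @ \oo --> (phi z : sigma_weak_topology K).
  have hc : (fun n => compress b n z) @ \oo --> (z : sigma_weak_topology K).
    exact: compress_cvg.
  by apply: cvg_comp hc _; exact: nphi.
have w v' u' : (ip K (phi (compress b n z) v') u' : R[i]^o) @[n --> \oo] -->
    (ip K (phi z v') u' : R[i]^o).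
  exact: (@sigma_weak_cvg_ip _ _ _ _ _ _ _ h v' u').
apply: bop_ext => v; apply: ip_ext => u; rewrite !bcompE adjoint_ip.
apply: (ccvg_unique (F := \oo) (f := fun n => ip K (phi (compress b n z) (a v)) u)).
  exact: w.
under eq_fun do rewrite -ha'// adjoint_ip.
exact: w.
Qed.

End TensorCommutant.

(** * The cocycle induced by a unit on a tensor factor *)

Section Intertwiners.
Variables (R : realType) (H : hilbert R) (phi : 'B(H) -> 'B(H)).
Hypothesis hphi : star_endomorphism phi.

Definition intertwiner (T : 'B(H)) := forall (x : 'B(H)) v, phi x (T v) = T (x v).

Lemma scalar_commutant (T : 'B(H)) : (forall (x : 'B(H)) v, T (x v) = x (T v)) ->
  exists c : R[i], forall v, T v = c *: v.
Proof.
move=> hT; have [u u1] := unit_vector H; exists (ip H (T u) u) => v.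
(* The operator |v><u| sends u to v, so T v = |v><u| T u = <T u, u> v. *)
by have := hT (rank1 v u) u; rewrite !rank1E ipvv u1 scale1r.
Qed.

Lemma adjoint_intertwiner T x v : intertwiner T ->
  adjoint T (phi x v) = x (adjoint T v).
Proof.
move=> hT; apply: ip_ext => w; rewrite adjoint_ipr.
have [_ _ st] := hphi.
rewrite -(adjointK x) -[phi _]adjointK -st adjoint_ipr adjointK.
by rewrite hT !adjoint_ipr.
Qed.

(** S^* T commutes with every operator. The scalar is the inner product that makes the intertwiners
    a Hilbert space. *)
Lemma intertwiner_scalar S T : intertwiner S -> intertwiner T ->
  exists c : R[i], forall v, adjoint S (T v) = c *: v.
Proof.
move=> hS hT; apply: (@scalar_commutant (adjoint S \oB T)) => x v.
by rewrite !bcompE -hT adjoint_intertwiner.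
Qed.

(** Since T^* T is scalar, T is a multiple of an isometry, and any unit vector u measures its
    norm. *)
Lemma intertwiner_nsq T u v : intertwiner T -> nsq u = 1 ->
  nsq (T v) = nsq (T u) * nsq v.
Proof.
move=> hT u1; have [c hc] := intertwiner_scalar hT hT.
have E w : (nsq (T w))%:C = c * (nsq w)%:C.
  by rewrite -!ipvv -adjoint_ipr hc ipZl.
have := E u; rewrite u1 mulr1 => cE.
by apply: (@complexI R); rewrite E -cE rmorphM.
Qed.

Lemma intertwiner_isometry T u : intertwiner T -> nsq u = 1 -> T u != 0 ->
  exists S, [/\ intertwiner S, forall v, adjoint S (S v) = v &
    exists2 c, c != 0 & S = c *: T].
Proof.
move=> hT u1 Tu0.
have n0 : 0 < nsq (T u) by rewrite lt_neqAle eq_sym nsq_eq0 Tu0 nsq_ge0.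
pose c := (Num.sqrt (nsq (T u)))^-1.
have c0 : c != 0 by rewrite invr_eq0 lt0r_neq0// sqrtr_gt0.
have hS : intertwiner (c%:C *: T).
  by move=> x v; rewrite !bopZE bopZr hT.
exists (c%:C *: T); split=> //; last first.
  by exists c%:C => //; rewrite eq_complex /= eqxx andbT.
move=> v; have [d hd] := intertwiner_scalar hS hS.
rewrite hd; suff -> : d = 1 by rewrite scale1r.
have := congr1 (fun w => ip H w u) (hd u).
rewrite adjoint_ipr !ipvv ipZl ipvv u1 mulr1 => <-.
by rewrite bopZE nsqZ csq_real exprVn sqr_sqrtr ?nsq_ge0// mulVf// lt0r_neq0.
Qed.

Lemma surjective_isometry_bijective S : intertwiner S ->
  (forall v, adjoint S (S v) = v) -> (forall v, S (adjoint S v) = v) -> bijective phi.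
Proof.
move=> hS iso co; exists (fun y => adjoint S \oB y \oB S) => x; apply: bop_ext => v.
  by rewrite !bcompE hS iso.
by rewrite -[in LHS](co v) hS !bcompE !co.
Qed.

End Intertwiners.

Lemma adjoint_nsq_le (R : realType) (H : hilbert R) (T : 'B(H)) (c : R) v :
  (forall w, nsq (T w) <= c * nsq w) -> nsq (adjoint T v) <= c * nsq v.
Proof.
move=> hT; have [->|n0] := eqVneq (nsq (adjoint T v)) 0.
  exact: le_trans (nsq_ge0 _) (hT v).
have np : 0 < nsq (adjoint T v) by rewrite lt_neqAle eq_sym n0 nsq_ge0.
rewrite -(ler_pM2l np) -expr2 -csq_real -ipvv adjoint_ipr.
rewrite (le_trans (cauchy_schwarz _ _))//.
rewrite (le_trans (ler_wpM2l (nsq_ge0 _) (hT _)))//.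
by rewrite mulrCA mulrA mulrC.
Qed.

Section Slices.
Variables (R : realType) (H1 H2 K : hilbert R) (tens : {bilinear H1 -> H2 -> K}).
Hypothesis ht : is_tensor_product tens.

(** In bra-ket form, (1 (x) <g|) V (1 (x) |h>). *)
Definition slice (V : 'B(K)) (g h : H2) : 'B(H1) :=
  adjoint (tensr ht g) \oB V \oB tensr ht h.

Lemma slice_ip V g h v w : ip H1 (slice V g h v) w = ip K (V (tens v h)) (tens w g).
Proof. by rewrite /slice !bcompE adjoint_ipr. Qed.

Lemma adjoint_slice_ip V g h v w :
  ip H1 (adjoint (slice V g h) v) w = ip K (tens v g) (V (tens w h)).
Proof. by rewrite adjoint_ipr ipC slice_ip -ipC. Qed.

Variables (beta : R -> 'B(H1) -> 'B(H1)) (gamma : R -> 'B(H2) -> 'B(H2))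
  (delta : R -> 'B(K) -> 'B(K)).
Hypotheses (gE : E0_semigroup gamma) (hd : is_tensor_semigroup tens beta gamma delta).

(** Slicing commutes with operators x (x) 1, and delta_t(x (x) 1) = beta_t(x) (x) 1. *)
Lemma slice_intertwiner t V g h : 0 <= t -> intertwiner (delta t) V ->
  intertwiner (beta t) (slice V g h).
Proof.
move=> t0 hV x v; have [X hX] := amplification ht x.
have hdX : is_tensor_operator tens (beta t x) (bid H2) (delta t X).
  by rewrite -(alpha_bid gE t0); exact: hd.2.
have comm z : beta t x (adjoint (tensr ht g) z) = adjoint (tensr ht g) (delta t X z).
  rewrite -!bcompE; congr (bop_fun _ z); apply: (tens_ext ht) => v' w'.
  rewrite !bcompE hdX -[tens v' w']/(tensr ht w' v') -[tens _ _]/(tensr ht w' (beta t x v')).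
  by rewrite !adjoint_tensr bopZr.
by rewrite /slice !bcompE comm hV /= hX.
Qed.

End Slices.

Record isometric_unit (R : realType) (H : hilbert R) (delta : R -> 'B(H) -> 'B(H))
    (V : R -> 'B(H)) : Prop := IsometricUnit {
  iu_iso : forall t z, 0 <= t -> nsq (V t z) = nsq z ;
  iu_add : forall s t, 0 <= s -> 0 <= t -> V (s + t) = V s \oB V t ;
  iu_intertwiner : forall t, 0 <= t -> intertwiner (delta t) (V t) ;
  iu_cont0 : forall z, V t z @[t --> 0^'+] --> z }.

Lemma pos_eq (R : realType) (H : hilbert R) (a b : 'B(H)) : pos a -> pos b ->
  (forall v, complex.Re (ip H (a v) v) = complex.Re (ip H (b v) v)) -> a = b.
Proof.
move=> pa pb hab.
have key (d : 'B(H)) : (forall x y, ip H (d x) y = ip H x (d y)) ->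
    (forall v, complex.Re (ip H (d v) v) = 0) -> forall v, d v = 0.
  move=> herm E v; apply/eqP; rewrite -nsq_eq0; apply/eqP.
  have := E (v + d v); rewrite bopDr ipDl !ipDr !cReD !E (herm (d v) v) /nsq; lra.
apply: bop_ext => v; apply/eqP; rewrite -subr_eq0 -bopBE; apply/eqP.
apply: key => [x y|w].
  by rewrite !bopBE ipBl ipBr (pos_herm _ _ pa) (pos_herm _ _ pb).
by rewrite bopBE ipBl cReD cReN hab subrr.
Qed.

Lemma eseries_ext (R : realType) (a b : nat -> \bar R) : (forall i, a i = b i) ->
  (\sum_(i <oo) a i = \sum_(i <oo) b i)%E.
Proof. by move=> /funext ->. Qed.

(** * The partial trace of an isometric unit *)

Section ReducedCocycle.
Variables (R : realType) (H1 H2 K : hilbert R) (tens : {bilinear H1 -> H2 -> K}).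
Hypothesis ht : is_tensor_product tens.
Variables (beta : R -> 'B(H1) -> 'B(H1)) (gamma : R -> 'B(H2) -> 'B(H2))
  (delta : R -> 'B(K) -> 'B(K)).
Hypotheses (bE : E0_semigroup beta) (gE : E0_semigroup gamma)
  (hd : is_tensor_semigroup tens beta gamma delta).
Variables (V : R -> 'B(K)) (hV : isometric_unit delta V).
Variables (g : nat -> H2) (hg : hbasis g) (j0 : nat).
Hypothesis f1 : nsq (g j0) = 1.

Let f := g j0.

(* The matrix coefficients of the unit [V t], seen as an element of the tensor
   product of the spaces of intertwiners of [beta t] and [gamma t]. *)
Definition coef t j : 'B(H1) := slice ht (V t) (g j) f.

Lemma coef_intertwiner t j : 0 <= t -> intertwiner (beta t) (coef t j).
Proof.
move=> t0; apply: (@slice_intertwiner _ _ _ _ _ ht _ _ _ gE hd _ _ _ _ t0).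
exact: iu_intertwiner.
Qed.

(** The terms are the squared components of V_t (w (x) f) along the [g j]; for a unit vector w this
    bounds the trace of rho_t by 1. *)
Lemma coef_bessel t n w : 0 <= t -> \sum_(0 <= j < n) nsq (coef t j w) <= nsq w.
Proof.
move=> t0; have := amp_bessel ht hg (V t (tens w f)) n.
by rewrite (iu_iso hV)// tens_nsq// f1 mulr1.
Qed.

Let u := sval (cid (unit_vector H1)).
Let u1 : nsq u = 1. Proof. by rewrite /u; case: cid. Qed.

(** Each T_j is |T_j u| times an isometry, so |T_j^* v|^2 <= |T_j u|^2 |v|^2: the operator norm is
    at most the trace. *)
Lemma adjoint_coef_bessel t n v : 0 <= t ->
  \sum_(0 <= j < n) nsq (adjoint (coef t j) v) <= nsq v.
Proof.
move=> t0; apply: (@le_trans _ _ (\sum_(0 <= j < n) nsq (coef t j u) * nsq v)).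
  apply: ler_sum => j _; apply: adjoint_nsq_le => w.
  rewrite (intertwiner_nsq (bE.2 t t0).1 w _ u1)//; exact: coef_intertwiner.
by rewrite -mulr_suml ler_piMl ?nsq_ge0// -u1 coef_bessel.
Qed.

Let r t n : 'B(H1) := \sum_(0 <= j < n) coef t j \oB adjoint (coef t j).

Let r_ip t n v w : ip H1 (r t n v) w =
  \sum_(0 <= j < n) ip H1 (adjoint (coef t j) v) (adjoint (coef t j) w).
Proof.
rewrite /r bop_sumE ip_suml; apply: eq_bigr => j _.
by rewrite bcompE -adjoint_ip.
Qed.

Let r_sub t m n : (m <= n)%N ->
  r t n - r t m = \sum_(m <= j < n) coef t j \oB adjoint (coef t j).
Proof.
move=> mn; rewrite /r (@big_cat_nat _ _ _ m 0 n)//=.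
by rewrite addrAC subrr add0r.
Qed.

Let r_pos_sub t m n : (m <= n)%N -> pos (r t n - r t m).
Proof.
move=> mn v; rewrite r_sub// bop_sumE ip_suml sumr_ge0// => j _.
by rewrite bcompE adjoint_ip ipvv ler0c nsq_ge0.
Qed.

Let r0 t : r t 0 = 0. Proof. by rewrite /r big_geq. Qed.

Let r_pos t n : pos (r t n).
Proof. by rewrite -(subr0 (r t n)) -(r0 t); exact: r_pos_sub. Qed.

Let r_nsq t n v : complex.Re (ip H1 (r t n v) v) =
  \sum_(0 <= j < n) nsq (adjoint (coef t j) v).
Proof. by rewrite r_ip cRe_sum. Qed.

Let r_le1 t n : 0 <= t -> pos (bid H1 - r t n).
Proof.
move=> t0 v; rewrite bopBE ipBl ipvv (pos_Re _ (r_pos t n)) -rmorphB ler0c subr_ge0.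
by rewrite r_nsq adjoint_coef_bessel.
Qed.

(** The condition on [t] stands under the existential so that choosing [a] defines [reduced] for
    every real [t]. *)
Lemma reduced_exists t : exists a : 'B(H1), 0 <= t ->
  forall v, series (fun j => coef t j (adjoint (coef t j) v)) @ \oo --> a v.
Proof.
have [t0|t0] := leP 0 t; last by exists 0.
have rE n v : r t n v = series (fun j => coef t j (adjoint (coef t j) v)) n.
  exact: bop_sumE.
have [||a ha _] := @lim_bop _ _ _ (r t) 1.
- by move=> n v; rewrite mul1r; exact: (pos_contract _ (r_pos t n) (r_le1 n t0)).
- move=> v; apply: (@sq_cauchy_cvg _ _ _ (fun n => complex.Re (ip H1 (r t n v) v)) (nsq v)).
    by move=> n; exact: (pos_le1 _ (r_le1 n t0)).
  move=> m n mn; rewrite -bopBE -cReN -cReD -ipBl -bopBE.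
  apply: pos_nsq; first exact: r_pos_sub.
  rewrite opprB addrCA; apply: posD; [exact: r_pos|exact: r_le1].
- exists a => _ v; have := ha v.
  by under eq_fun do rewrite rE.
Qed.

(* The partial trace over [H2] of [V t o (1 (x) |f><f|) o (V t)^*]; as an element
   of the commutant of the range of [beta t] it is the density matrix to which
   the pure state given by the unit [V t] restricts. *)
Definition reduced t : 'B(H1) := sval (cid (reduced_exists t)).

Lemma reduced_cvg t v : 0 <= t ->
  series (fun j => coef t j (adjoint (coef t j) v)) @ \oo --> reduced t v.
Proof. by move=> t0; rewrite /reduced; case: cid => a /= /(_ t0). Qed.

Lemma reduced_ip t v w : 0 <= t ->
  (ip H1 (r t n v) w : R[i]^o) @[n --> \oo] --> (ip H1 (reduced t v) w : R[i]^o).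
Proof.
move=> t0; have rE n : r t n v = series (fun j => coef t j (adjoint (coef t j) v)) n.
  exact: bop_sumE.
by under eq_fun do rewrite rE; apply: ip_cvgl; exact: reduced_cvg.
Qed.

Lemma reduced_nsq t v : 0 <= t ->
  series (fun j => nsq (adjoint (coef t j) v)) @ \oo --> complex.Re (ip H1 (reduced t v) v).
Proof.
move=> t0; have -> : series (fun j => nsq (adjoint (coef t j) v)) =
    (fun n => complex.Re (ip H1 (r t n v) v)) by apply/funext => n; rewrite r_nsq.
by apply: cvg_Re; exact: reduced_ip.
Qed.

Lemma reduced_pos t : 0 <= t -> pos (reduced t).
Proof.
move=> t0 v; apply: (@ccvg_ge0 R (fun n => ip H1 (r t n v) v)).
  by move=> n; exact: r_pos.
exact: reduced_ip.
Qed.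

Lemma reduced_le1 t : 0 <= t -> pos (bid H1 - reduced t).
Proof.
move=> t0 v; rewrite bopBE ipBl ipvv (pos_Re _ (reduced_pos t0)) -rmorphB ler0c subr_ge0.
by apply: (cvg_le_cst (@reduced_nsq t v t0)) => n; exact: adjoint_coef_bessel.
Qed.

Lemma reduced_comm t x : 0 <= t -> reduced t \oB beta t x = beta t x \oB reduced t.
Proof.
move=> t0; apply: bop_ext => v; rewrite !bcompE.
apply: (hcvg_unique (F := \oo) (f := fun n => beta t x
  (series (fun j => coef t j (adjoint (coef t j) v)) n))); last first.
  by apply: bop_cvg; exact: reduced_cvg.
have E n : beta t x (series (fun j => coef t j (adjoint (coef t j) v)) n) =
    series (fun j => coef t j (adjoint (coef t j) (beta t x v))) n.
  rewrite /series /= bop_sumr; apply: eq_bigr => j _.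
  have hj := coef_intertwiner j t0.
  by rewrite hj (adjoint_intertwiner (bE.2 t t0).1 _ _ hj).
by under eq_fun do rewrite E; exact: reduced_cvg.
Qed.

(** The single term [j0] is enough, which is why [f] is taken among the basis vectors: |T_j0^* v|^2
    |v|^2 is at least |<v (x) f, V_t (v (x) f)>|^2, which tends to |v|^4. *)
Lemma reduced_cont0 v : complex.Re (ip H1 (reduced t v) v) @[t --> 0^'+] --> nsq v.
Proof.
have [->|v0] := eqVneq v 0.
  by rewrite nsq0; under eq_fun do rewrite ip0r /=; exact: cvg_cst.
have vp : 0 < nsq v by rewrite lt_neqAle eq_sym nsq_eq0 v0 nsq_ge0.
apply: (@squeeze_cvgr _ _ _ _
  (fun t => complex.Re (ip K (tens v f) (V t (tens v f))) ^+ 2 / nsq v) (cst (nsq v))).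
- near=> t; have t0 : 0 <= t by near: t; exact: nbhs_right_ge.
  apply/andP; split; last exact: (pos_le1 _ (reduced_le1 t0)).
  rewrite ler_pdivrMr//.
  apply: (@le_trans _ _ (nsq (adjoint (coef t j0) v) * nsq v)).
    rewrite (le_trans (cRe_sqr_le _))// -(adjoint_slice_ip ht).
    exact: cauchy_schwarz.
  rewrite ler_wpM2r ?nsq_ge0//.
  rewrite -(cvg_lim _ (@reduced_nsq t v t0))//; apply: limr_ge.
    by apply/cvg_ex; eexists; exact: reduced_nsq.
  exists j0.+1 => // n /= jn; rewrite /series /= (@big_cat_nat _ _ _ j0.+1)//=.
  rewrite big_nat_recr//= -addrA addrCA lerDl addr_ge0// sumr_ge0// => i _; exact: nsq_ge0.
- rewrite [X in _ --> X](_ : _ = nsq v ^+ 2 / nsq v); last by rewrite expr2 mulfK// lt0r_neq0.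
  apply: cvgMl; apply: cvg_sqr.
  rewrite [X in _ --> X](_ : _ = complex.Re (ip K (tens v f) (tens v f))); last first.
    by rewrite tens_ip// !ipvv f1 -rmorphM /= mulr1.
  by apply: cvg_Re; apply: ip_cvgr; exact: (@iu_cont0 _ _ _ _ hV (tens v f)).
- exact: cvg_cst.
Unshelve. all: end_near. Qed.

Let ht' := tflip_product ht.
Let hd' := tflip_semigroup hd.

Let slice2 t v y : 'B(H2) := slice ht' (V t) v y.

Let slice2E t v y h : slice2 t v y h = adjoint (tensr ht' v) (V t (tens y h)).
Proof. by []. Qed.

Let slice2_intertwiner t v y : 0 <= t -> intertwiner (gamma t) (slice2 t v y).
Proof.
move=> t0; apply: (@slice_intertwiner _ _ _ _ _ ht' _ _ _ bE hd' _ _ _ _ t0).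
exact: iu_intertwiner.
Qed.

Let left_parseval v z :
  (\sum_(j <oo) (csq (ip K (tens v (g j)) z))%:E = (nsq (adjoint (tensr ht' v) z))%:E)%E.
Proof.
rewrite -(parseval_ereal hg); apply: eseries_ext => j.
by rewrite adjoint_ipr csq_ip_sym.
Qed.

(* Since the slices are intertwiners of [gamma], the vector [f] may be replaced
   by any other unit vector: this makes the partial trace multiplicative. *)
Let left_expansion t v z : 0 <= t ->
  (\sum_(k <oo) (nsq (slice2 t v (adjoint (tensr ht (g k)) z) f))%:E =
   (nsq (adjoint (tensr ht' v) (V t z)))%:E)%E.
Proof.
move=> t0; apply: series_EFin.
pose y k := adjoint (tensr ht (g k)) z; pose x k := slice2 t v (y k) (g k).
(* The product S^* T is scalar for the slices S, T, so orthogonality of the [g k] passes to their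
   images. *)
have xo i j : i != j -> ip H2 (x i) (x j) = 0.
  move=> ij; rewrite /x -adjoint_ipr.
  have [c ->] := intertwiner_scalar (gE.2 t t0).1
    (slice2_intertwiner v (y j) t0) (slice2_intertwiner v (y i) t0).
  by rewrite ipZl (hb_orth hg)// mulr0.
have xf k : nsq (x k) = nsq (slice2 t v (y k) f).
  have [g0|g1] := hb_norm hg k; last first.
    rewrite /x (intertwiner_nsq (gE.2 t t0).1 _ (slice2_intertwiner v (y k) t0) f1).
    by rewrite g1 mulr1.
  have y0 : y k = 0.
    by apply: ip_ext => w; rewrite adjoint_ipr ip0l /= g0 linear0r ip0r.
  by rewrite /x y0 !slice2E !linear0l !bop0r.
have E : series (fun k => nsq (slice2 t v (y k) f)) =
    (fun n => nsq ((adjoint (tensr ht' v) \oB V t)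
      (series (fun k => tensr ht (g k) (y k)) n))).
  apply/funext => n; rewrite /series /= !bop_sumr orth_nsq; last exact: xo.
  by apply: eq_bigr => k _; rewrite -xf.
rewrite E; apply: nsq_cvg; apply: bop_cvg; exact: tens_expansion.
Qed.

(** Expanding V_t (e_i (x) f) along the [g k] puts V_s on vectors ending in [g k]; [left_expansion]
    replaces these by [f]. The left side thus becomes the triple series of the [F i k j], and
    summing over i, then k, then j gives the right side. *)
Lemma reduced_add s t : 0 <= s -> 0 <= t ->
  reduced (s + t) = reduced s \oB beta s (reduced t).
Proof.
move=> s0 t0; have st0 : 0 <= s + t by rewrite addr_ge0.
have [e he] := hbasis_exists H1.
have pbt : pos (beta s (reduced t)) by apply: (alpha_pos bE s0); exact: reduced_pos.
apply: pos_eq; first exact: reduced_pos.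
  apply: (cp_pos (phi := fun x => reduced s \oB beta s x)); last exact: reduced_pos.
  apply: cp_comm_pos; [exact: (cps_cp bE.1)|exact: reduced_pos|exact: reduced_le1|].
  by move=> x; exact: reduced_comm.
move=> v; apply: EFin_inj.
pose F i k j : \bar R := (csq (ip H1 (adjoint (coef t k) (adjoint (coef s j) v)) (e i)))%:E.
have F0 i k j : (0 <= F i k j)%E by rewrite lee_fin csq_ge0.
transitivity (\sum_(i <oo) \sum_(k <oo) \sum_(j <oo) F i k j)%E.
  rewrite -(series_EFin (@reduced_nsq (s + t) v st0)).
  under eseries_ext do rewrite -(parseval_ereal he).
  rewrite nneseries_interchange; last by move=> *; rewrite lee_fin csq_ge0.
  apply: eseries_ext => i.
  have -> : (\sum_(j <oo) (csq (ip H1 (adjoint (coef (s + t) j) v) (e i)))%:E =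
      \sum_(j <oo) (csq (ip K (tens v (g j)) (V s (V t (tens (e i) f)))))%:E)%E.
    by apply: eseries_ext => j; rewrite adjoint_slice_ip (iu_add hV).
  rewrite left_parseval -left_expansion//; apply: eseries_ext => k.
  rewrite slice2E -left_parseval; apply: eseries_ext => j.
  by rewrite /F adjoint_ipr adjoint_slice_ip.
transitivity (\sum_(j <oo) \sum_(k <oo) \sum_(i <oo) F i k j)%E.
  under [RHS]eseries_ext do rewrite nneseries_interchange//.
  rewrite [RHS]nneseries_interchange; last first.
    by move=> *; apply: nneseries_ge0 => *; exact: F0.
  by apply: eseries_ext => i; rewrite nneseries_interchange.
have h : series (fun j => complex.Re (ip H1 (reduced t (adjoint (coef s j) v))
    (adjoint (coef s j) v))) @ \oo -->
    complex.Re (ip H1 ((reduced s \oB beta s (reduced t)) v) v).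
  have E : series (fun j => complex.Re (ip H1 (reduced t (adjoint (coef s j) v))
      (adjoint (coef s j) v))) = (fun n => complex.Re (ip H1
      (series (fun j => coef s j (adjoint (coef s j) (beta s (reduced t) v))) n) v)).
    apply/funext => n; rewrite /series ip_suml cRe_sum; apply: eq_bigr => j _.
    by rewrite (adjoint_intertwiner (bE.2 s s0).1 _ _ (coef_intertwiner j s0)) [in RHS]adjoint_ip.
  by rewrite E; apply: cvg_Re; apply: ip_cvgl; exact: reduced_cvg.
rewrite -(series_EFin h); apply: eseries_ext => j.
rewrite -(series_EFin (@reduced_nsq t _ t0)); apply: eseries_ext => k.
by rewrite -(parseval_ereal he).
Qed.

Lemma reduced_local_cocycle : local_cocycle beta reduced.
Proof.
split; [exact: reduced_pos|exact: reduced_le1|exact: reduced_comm|exact: reduced_add|].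
exact: reduced_cont0.
Qed.

(* [reduced t] has trace 1 on the space of intertwiners of [beta t], so a lower
   bound above 1/2 leaves no room for two orthogonal intertwiners. *)
Lemma reduced_bijective t (c : R) : 0 <= t -> 1 / 2 < c ->
  (forall v, c * nsq v <= complex.Re (ip H1 (reduced t v) v)) -> bijective (beta t).
Proof.
move=> t0 hc hlow; have bs := (bE.2 t t0).1.
have Ti j := coef_intertwiner j t0.
have c0 : 0 < c by apply: lt_trans hc; rewrite divr_gt0.
have intZ T v : intertwiner (beta t) T -> T u = 0 -> T v = 0.
  move=> hT Tu; apply/eqP; rewrite -nsq_eq0 (intertwiner_nsq bs _ hT u1) Tu nsq0.
  by rewrite mul0r.
have red0 v : (forall j, adjoint (coef t j) v = 0) -> v = 0.
  move=> hv; apply/eqP; rewrite -nsq_eq0 eq_le nsq_ge0 andbT.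
  rewrite -(pmulr_rle0 _ c0) (le_trans (hlow v))//.
  apply: (cvg_le_cst (@reduced_nsq t v t0)) => n.
  by rewrite /series /= big1// => j _; rewrite hv nsq0.
have [j1 Tj1] : exists j, coef t j u != 0.
  apply: contrapT => h; have : u = 0.
    apply: red0 => j; apply: ip_ext => w; rewrite adjoint_ipr ip0l.
    suff -> : coef t j w = 0 by rewrite ip0r.
    apply: intZ => //; apply/eqP; apply: contrapT => /negP hj.
    by apply: h; exists j.
  by move=> u0; move: u1; rewrite u0 nsq0 => /eqP; rewrite eq_sym oner_eq0.
have [S [hS isoS _]] := intertwiner_isometry bs (Ti j1) u1 Tj1.
have range k v : coef t k v = S (adjoint S (coef t k v)).
  (* The component of [coef t k] orthogonal to the range of [S]; if nonzero, it normalizes to an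
     isometric intertwiner [S'] with range orthogonal to that of [S]. *)
  pose T' : 'B(H1) := coef t k - S \oB adjoint S \oB coef t k.
  have hT' : intertwiner (beta t) T'.
    by move=> x w; rewrite /T' !bopBE !bcompE bopBr !hS -(adjoint_intertwiner bs _ _ hS) !Ti.
  have ST' w : adjoint S (T' w) = 0.
    by rewrite /T' bopBE bopBr !bcompE isoS subrr.
  have [T'0|T'0] := eqVneq (T' u) 0.
    apply/eqP; rewrite -subr_eq0; apply/eqP; exact: (intZ T' v hT' T'0).
  have [S' [hS' isoS' [d d0 S'E]]] := intertwiner_isometry bs hT' u1 T'0.
  have SS' w : adjoint S (S' w) = 0 by rewrite S'E bopZE bopZr ST' scaler0.
  have isoN (Z : 'B(H1)) : (forall w, adjoint Z (Z w) = w) -> forall w, nsq (Z w) = nsq w.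
    by move=> h w; rewrite /nsq -adjoint_ipr h.
  (* The scalars T_j^* Z and Z^* T_j are conjugate. *)
  have sw Z j w : intertwiner (beta t) Z ->
      nsq (adjoint (coef t j) (Z w)) = nsq (adjoint Z (coef t j w)).
    move=> hZ; have [a ha] := intertwiner_scalar bs (Ti j) hZ.
    have hb x : adjoint Z (coef t j x) = conjc a *: x.
      by apply: ip_ext => y; rewrite adjoint_ipr adjoint_ip ha ipZl ipZr.
    by rewrite ha hb !nsqZ csq_conj.
  have bess x : nsq (adjoint S x) + nsq (adjoint S' x) <= nsq x.
    have := nsq_ge0 (x - (S (adjoint S x) + S' (adjoint S' x))).
    have o : ip H1 (S (adjoint S x)) (S' (adjoint S' x)) = 0.
      by rewrite adjoint_ip SS' ip0r.
    rewrite nsqB nsqD (isoN S isoS) (isoN S' isoS') o ipDr cReD.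
    rewrite -(adjoint_ipr S) -(adjoint_ipr S') -!/(nsq _) /=.
    by lra.
  (* The lower bound is tested at S u and S' u; by [sw] and [bess] the two values together are at
     most the sum of the |T_j u|^2. *)
  have : c + c <= 1.
    have hl := lerD (hlow (S u)) (hlow (S' u)).
    rewrite (isoN S isoS) (isoN S' isoS') u1 !mulr1 in hl; apply: le_trans hl _.
    have h2 : series (fun j => nsq (adjoint (coef t j) (S u))) n +
        series (fun j => nsq (adjoint (coef t j) (S' u))) n @[n --> \oo] -->
        complex.Re (ip H1 (reduced t (S u)) (S u)) +
        complex.Re (ip H1 (reduced t (S' u)) (S' u)).
      by apply: cvgD; exact: reduced_nsq.
    apply: (cvg_le_cst h2) => n; rewrite /series /= -big_split /= -u1.
    rewrite (le_trans _ (coef_bessel n u t0))//; apply: ler_sum => j _.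
    by rewrite !sw.
  by move=> h; exfalso; move: hc h; lra.
(* Every T_j has its range in that of S, so a vector orthogonal to the latter is killed by all T_j^*
   and vanishes by the lower bound. *)
apply: (surjective_isometry_bijective hS isoS) => v.
apply/eqP; rewrite eq_sym -subr_eq0; apply/eqP/red0 => j.
apply: ip_ext => w; rewrite adjoint_ipr range -adjoint_ipr bopBr isoS subrr ip0l.
by rewrite ip0l.
Qed.

End ReducedCocycle.

Lemma semigroup_ind (R : realType) (P : R -> Prop) :
  (\forall r \near 0^'+, P r) ->
  (forall s t, 0 < s -> 0 < t -> P s -> P t -> P (s + t)) ->
  forall t, 0 < t -> P t.
Proof.
move=> [e /= e0 he] hadd t t0.
have [n hn] : exists n : nat, t / e < n.+1%:R.
  exists (Num.bound (t / e)); apply: (lt_le_trans (archi_boundP _)).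
    by rewrite divr_ge0 ?ltW.
  by rewrite ler_nat.
pose r := t / n.+1%:R.
have r0 : 0 < r by rewrite divr_gt0// ltr0n.
have Pr : P r.
  apply: he => //=; rewrite sub0r normrN gtr0_norm// ltr_pdivrMr ?ltr0n//.
  by rewrite mulrC -ltr_pdivrMr.
have key m : P (m.+1%:R * r).
  elim: m => [|m IH]; first by rewrite mul1r.
  rewrite -[m.+2]addn1 natrD mulrDl mul1r; apply: hadd => //.
  by rewrite mulr_gt0// ltr0n.
by have := key n; rewrite /r mulrC divfK// pnatr_eq0.
Qed.

Lemma hcvg_sum (R : realType) (H : hilbert R) (T : Type) (F : set_system T)
    {FF : Filter F} I (r : seq I) (f : I -> T -> H) (a : I -> H) :
  (forall i, f i t @[t --> F] --> a i) ->
  \sum_(i <- r) f i t @[t --> F] --> \sum_(i <- r) a i.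
Proof.
move=> fa; elim: r => [|i r IH].
  by rewrite big_nil; under eq_fun do rewrite big_nil; exact: cvg_cst.
rewrite big_cons; under eq_fun do rewrite big_cons.
by apply: cvgD; [exact: fa|exact: IH].
Qed.

Lemma at_right_within (R : realType) (T : topologicalType) (f : R -> T) (l : T) :
  f t @[t --> within `[0, +oo[ (nbhs (0 : R))] --> l -> f t @[t --> 0^'+] --> l.
Proof.
move=> h; apply: cvg_trans h; apply: cvg_app => A [e /= e0 he].
exists e => //= t te t0; apply: he => //=.
by rewrite /= in_itv /= andbT ltW.
Qed.

Lemma strongly_continuous_at0 (R : realType) (H : hilbert R) (U : R -> 'B(H)) :
  strongly_continuous U -> U 0 = bid H -> forall v, U t v @[t --> 0^'+] --> v.
Proof.
move=> hU U0 v; have h := (subspace_continuousP _ _).1 (@hU v) 0.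
rewrite [X in _ --> X](_ : v = U 0 v); last by rewrite U0.
by apply: at_right_within; apply: h; rewrite /= in_itv /= lexx.
Qed.

(** * Units and cocycle conjugacy *)

Section IsometricUnit.
Variables (R : realType) (H : hilbert R) (alpha : R -> 'B(H) -> 'B(H)).
Hypothesis aE : E0_semigroup alpha.

(** U_t is sqrt(e_t) times an isometry, where e_t = |U_t u|^2 is multiplicative. Continuity gives
    e_t > 0 near 0, hence everywhere, so dividing by sqrt(e_t) keeps the semigroup law. *)
Lemma isometric_unit_exists : spatial alpha -> exists V, isometric_unit alpha V.
Proof.
move=> [U [Uc U0 Ua Ui]]; have [u u1] := unit_vector H.
have Ucv := strongly_continuous_at0 Uc U0.
have Uint t : 0 <= t -> intertwiner (alpha t) (U t).
  by move=> t0 x v; rewrite -!bcompE Ui.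
pose e t := nsq (U t u).
have eE t v : 0 <= t -> nsq (U t v) = e t * nsq v.
  by move=> t0; exact: (intertwiner_nsq (aE.2 t t0).1 v (Uint t t0) u1).
have ead s t : 0 <= s -> 0 <= t -> e (s + t) = e s * e t.
  by move=> s0 t0; rewrite {1}/e Ua// bcompE eE.
have ec : e t @[t --> 0^'+] --> (1 : R) by rewrite -u1; apply: nsq_cvg; exact: Ucv.
have e0 : e 0 = 1 by rewrite /e U0.
have ep t : 0 <= t -> 0 < e t.
  rewrite le_eqVlt => /orP[/eqP<-|]; first by rewrite e0.
  move: t; apply: semigroup_ind => [|s t s0 t0]; last first.
    by rewrite ead ?ltW//; exact: mulr_gt0.
  exact: (cvgr_gt _ ec).
pose V t : 'B(H) := ((Num.sqrt (e t))^-1)%:C *: U t.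
have cE t : 0 <= t -> (Num.sqrt (e t))^-1 ^+ 2 * e t = 1.
  move=> t0; rewrite exprVn sqr_sqrtr ?mulVf// ?lt0r_neq0 ?ep// ltW// ep//.
exists V; split.
- by move=> t z t0; rewrite bopZE nsqZ csq_real eE// mulrA cE// mul1r.
- move=> s t s0 t0; apply: bop_ext => v; rewrite /V !(bcompE, bopZE) Ua// bcompE ead//.
  by rewrite bopZr scalerA -rmorphM -invfM sqrtrM// ltW// ep.
- by move=> t t0 x v; rewrite !bopZE bopZr Uint.
- move=> z; apply: (@hcvg_le _ _ _ _ _ _ _ (fun t =>
    2 * (((Num.sqrt (e t))^-1 - 1) ^+ 2 * nsq (U t z)) + 2 * nsq (U t z - z))).
    move=> t; rewrite /V bopZE; set c := _^-1.
    have -> : c%:C *: U t z - z = (c - 1)%:C *: U t z + (U t z - z).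
      by rewrite rmorphB /= scalerBl scale1r addrA subrK.
    by apply: le_trans (nsqD_le _ _) _; rewrite nsqZ csq_real.
  have c1 : (Num.sqrt (e t))^-1 - 1 @[t --> 0^'+] --> (0 : R).
    rewrite [X in _ --> X](_ : _ = (Num.sqrt 1)^-1 - 1); last by rewrite sqrtr1 invr1 subrr.
    apply: cvgB; last exact: cvg_cst.
    apply: cvgV; first by rewrite sqrtr1 oner_eq0.
    by apply: continuous_cvg ec; exact: sqrt_continuous.
  have /hcvgP c2 := @Ucv z.
  rewrite [X in _ --> X](_ : _ = 2 * (0 ^+ 2 * nsq z) + 2 * 0); last first.
    by rewrite expr0n mul0r !mulr0 addr0.
  apply: cvgD; apply: cvgMr => //; apply: cvgM; first exact: cvg_sqr.
  by apply: nsq_cvg; exact: Ucv.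
Qed.

End IsometricUnit.

Section Amplified.
Variables (R : realType) (H1 H2 K : hilbert R) (tens : {bilinear H1 -> H2 -> K}).
Hypothesis ht : is_tensor_product tens.

Lemma amplification_pos x y : is_tensor_operator tens x (bid H2) y -> pos x -> pos y.
Proof.
move=> hy px z; have [g hg] := hbasis_exists H2.
have [y' hy' cy] := amplification_subproof ht hg x.
have -> : y = y' by apply: (tens_ext ht) => v w; rewrite hy hy'.
apply: (@ccvg_ge0 R (fun n => ip K (series (fun k => tensr ht (g k)
  (x (adjoint (tensr ht (g k)) z))) n) z)).
  by move=> n; rewrite /series ip_suml sumr_ge0// => k _; rewrite adjoint_ip px.
by apply: ip_cvgl; exact: cy.
Qed.

Variables (beta : R -> 'B(H1) -> 'B(H1)) (gamma : R -> 'B(H2) -> 'B(H2))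
  (delta : R -> 'B(K) -> 'B(K)).
Hypotheses (bE : E0_semigroup beta) (gE : E0_semigroup gamma)
  (hd : is_tensor_semigroup tens beta gamma delta).

Lemma amplified_cocycle rho : local_cocycle beta rho ->
  exists2 A, local_cocycle delta A &
    forall t, is_tensor_operator tens (rho t) (bid H2) (A t).
Proof.
move=> hrho; have [A hA] := choice (fun t => amplification ht (rho t)).
exists A => //.
have dE := hd.1; have dC := dE.1.
have Ap t : 0 <= t -> pos (A t).
  by move=> t0; exact: (amplification_pos (hA t) (lc_pos hrho t0)).
have A1 t : 0 <= t -> pos (bid K - A t).
  move=> t0; apply: (amplification_pos _ (lc_le1 hrho t0)) => v w.
  by rewrite !bopBE hA /= linearBl.
have strong z : A t z @[t --> 0^'+] --> z.
  have ctens v w : A t (tens v w) @[t --> 0^'+] --> tens v w.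
    under eq_fun do rewrite hA.
    by apply: (bop_cvg (x := tensr ht w)); exact: (@lc_near0 _ _ _ _ hrho v).
  apply/hcvgP/cvgrPdist_lt => e e0.
  (* Two uses of [nsqD_le] weight the three errors by 2, 4 and 4, and 10/16 < 1. *)
  have e16 : 0 < e / 16 by rewrite divr_gt0.
  have [x [n [v [w xE]]] xz] := dense_nsq ht.2 z e16.
  have cx : A t x @[t --> 0^'+] --> x.
    rewrite xE; under eq_fun do rewrite bop_sumr.
    by apply: hcvg_sum => i; exact: ctens.
  move/hcvgP/cvgrPdist_lt: cx => /(_ _ e16) cx.
  near=> t; have t0 : 0 <= t by near: t; exact: nbhs_right_ge.
  rewrite sub0r normrN ger0_norm ?nsq_ge0//.
  have h1 : nsq (A t x - x) < e / 16.
    have : `|0 - nsq (A t x - x)| < e / 16 by near: t.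
    by rewrite sub0r normrN ger0_norm ?nsq_ge0.
  have h2 : nsq (A t (z - x)) <= nsq (x - z).
    by rewrite [leRHS]nsqBC; exact: (pos_contract _ (Ap t t0) (A1 t t0)).
  have -> : A t z - z = A t (z - x) + ((A t x - x) + (x - z)).
    by rewrite bopBr !addrA !subrK.
  apply: le_lt_trans (nsqD_le _ _) _.
  have := nsqD_le (A t x - x) (x - z); move: h1 h2 xz.
  set a1 := nsq _; set a2 := nsq _; set a3 := nsq _; set a4 := nsq _; lra.
split=> //.
- move=> t x t0; move: x; apply: (commute_normal ht).
  + exact: alpha_lin.
  + exact: (cps_normal dC t0).
  + move=> x y z hz; apply: (tens_ext ht) => v w; rewrite !bcompE.
    have h := hd.2 t x y z t0 hz.
    by rewrite h !hA h /= -!bcompE (lc_comm hrho).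
- move=> s t s0 t0; apply: (tens_ext ht) => v w; rewrite bcompE hA.
  have h := hd.2 s (rho t) (bid H2) (A t) s0 (hA t).
  by rewrite h hA (lc_add hrho)// (alpha_bid gE s0).
- by move=> z; apply: cvg_Re; apply: ip_cvgl.
Unshelve. all: end_near. Qed.

End Amplified.

Section CocycleConjugacy.
Variables (R : realType) (H K : hilbert R).
Variables (alpha : R -> 'B(H) -> 'B(H)) (delta : R -> 'B(K) -> 'B(K)).
Hypotheses (aE : E0_semigroup alpha) (dE : E0_semigroup delta).
Variables (W : bop H K) (C : R -> 'B(K)).
Hypotheses (hW : unitary W) (hC : cocycle delta C).
Hypothesis conjE : forall t x, 0 <= t ->
  W \oB alpha t (adjoint W \oB x \oB W) \oB adjoint W = C t \oB delta t x \oB adjoint (C t).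

Let WK v : adjoint W (W v) = v. Proof. by rewrite -bcompE hW.1. Qed.
Let KW z : W (adjoint W z) = z. Proof. by rewrite -bcompE hW.2. Qed.
Let CK t z : 0 <= t -> adjoint (C t) (C t z) = z.
Proof. by move=> t0; have [_ /(_ t t0)[h _] _] := hC; rewrite -bcompE h. Qed.
Let KC t z : 0 <= t -> C t (adjoint (C t) z) = z.
Proof. by move=> t0; have [_ /(_ t t0)[_ h] _] := hC; rewrite -bcompE h. Qed.

Let nsqW v : nsq (W v) = nsq v.
Proof. by rewrite /nsq -adjoint_ipr WK. Qed.
Let nsqWa z : nsq (adjoint W z) = nsq z.
Proof. by rewrite -nsqW KW. Qed.
Let nsqC t z : 0 <= t -> nsq (C t z) = nsq z.
Proof. by move=> t0; rewrite /nsq -adjoint_ipr CK. Qed.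
Let nsqCa t z : 0 <= t -> nsq (adjoint (C t) z) = nsq z.
Proof. by move=> t0; rewrite -(nsqC _ t0) KC. Qed.

Let C0 : C 0 = bid K.
Proof.
have [_ _ /(_ 0 0 (lexx 0) (lexx 0))] := hC; rewrite addr0 (cps_0 dE.1) => h.
apply: bop_ext => z; have := congr1 (fun y : 'B(K) => adjoint (C 0) (y z)) h.
by rewrite bcompE !CK.
Qed.

(** For unitaries |C_t^* z - z| = |z - C_t z|, so strong continuity at 0 passes to the adjoints. *)
Let Ca_cvg0 z : adjoint (C t) z @[t --> 0^'+] --> z.
Proof.
have [Cs _ _] := hC; have /hcvgP h := strongly_continuous_at0 Cs C0 (v := z).
apply/hcvgP; apply: cvg_trans h; apply: near_eq_cvg; near=> t.
have t0 : 0 <= t by near: t; exact: nbhs_right_ge.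
by rewrite -[LHS](nsqCa _ t0) bopBr CK// nsqBC.
Unshelve. all: end_near. Qed.

Let delta_conj t x z : 0 <= t ->
  delta t x (adjoint (C t) z) = adjoint (C t) (W (alpha t (adjoint W \oB x \oB W) (adjoint W z))).
Proof.
move=> t0; have := congr1 (fun y : 'B(K) => adjoint (C t) (y z)) (conjE x t0).
by rewrite !bcompE CK.
Qed.

Let alpha_conj t x v : 0 <= t ->
  alpha t x v = adjoint W (C t (delta t (W \oB x \oB adjoint W) (adjoint (C t) (W v)))).
Proof.
move=> t0; rewrite delta_conj// KC// WK WK; congr (alpha t _ v).
by apply: bop_ext => w; rewrite !bcompE !WK.
Qed.

Let delta_mul t x y : 0 <= t -> delta t (x \oB y) = delta t x \oB delta t y.
Proof. by move=> t0; have [[_ -> _] _] := dE.2 t t0. Qed.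

Let delta_adj t x : 0 <= t -> delta t (adjoint x) = adjoint (delta t x).
Proof. by move=> t0; have [[_ _ ->] _] := dE.2 t t0. Qed.

Let C_add s t : 0 <= s -> 0 <= t -> C (s + t) = C s \oB delta s (C t).
Proof. by move=> s0 t0; have [_ _ ->] := hC. Qed.

(** With D_t the adjoint of C_t, the cocycle law reads D_(s+t) = delta_s(D_t) D_s; the intertwining
    relation at time s moves delta_s(D_t) to the right, where it becomes D_t. *)
Lemma conjugate_unit V : isometric_unit alpha V ->
  isometric_unit delta (fun t => adjoint (C t) \oB W \oB V t \oB adjoint W).
Proof.
move=> hV.
have hint t : 0 <= t -> intertwiner (delta t) (adjoint (C t) \oB W \oB V t \oB adjoint W).
  move=> t0 x z; rewrite !bcompE delta_conj// WK (iu_intertwiner hV)//.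
  by rewrite !bcompE KW.
split=> //.
- by move=> t z t0; rewrite !bcompE nsqCa// nsqW (iu_iso hV)// nsqWa.
- move=> s t s0 t0; apply: bop_ext => z; rewrite !bcompE.
  rewrite (iu_add hV)// C_add// adjoint_comp -delta_adj// !bcompE.
  have := hint s s0 (adjoint (C t)) (W (V t (adjoint W z))).
  by rewrite !bcompE !WK.
- move=> z; have cy : W (V t (adjoint W z)) @[t --> 0^'+] --> z.
    rewrite [X in _ --> X](_ : z = W (adjoint W z)); last by rewrite KW.
    by apply: bop_cvg; exact: (@iu_cont0 _ _ _ _ hV).
  apply/hcvgP; move/hcvgP: cy => c1; have /hcvgP c2 := @Ca_cvg0 z.
  apply: (@squeeze_cvgr _ _ _ _ (cst 0) (fun t =>
    2 * nsq (W (V t (adjoint W z)) - z) + 2 * nsq (adjoint (C t) z - z))).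
  + near=> t; have t0 : 0 <= t by near: t; exact: nbhs_right_ge.
    rewrite nsq_ge0 /= -(nsqCa (W _ - z) t0) bopBr.
    apply: le_trans (nsqD_le _ _).
    by rewrite addrA subrK.
  + exact: cvg_cst.
  + rewrite [X in _ --> X](_ : _ = 2 * 0 + 2 * 0); last by rewrite !mulr0 addr0.
    by apply: cvgD; apply: cvgMr.
Unshelve. all: end_near. Qed.

Definition conjugate_cocycle (A : R -> 'B(K)) (t : R) : 'B(H) :=
  adjoint (adjoint (C t) \oB W) \oB A t \oB (adjoint (C t) \oB W).

Lemma conjugate_cocycleE A t v : conjugate_cocycle A t v =
  adjoint W (C t (A t (adjoint (C t) (W v)))).
Proof. by rewrite /conjugate_cocycle adjoint_comp adjointK !bcompE. Qed.

Lemma conjugate_cocycle_ip A t z : 0 <= t ->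
  ip H (conjugate_cocycle A t (adjoint W (C t z))) (adjoint W (C t z)) = ip K (A t z) z.
Proof.
by move=> t0; rewrite /conjugate_cocycle !bcompE adjoint_ipr bcompE KW CK.
Qed.

Lemma conjugate_local_cocycle A : local_cocycle delta A ->
  local_cocycle alpha (conjugate_cocycle A).
Proof.
move=> hA; split.
- by move=> t t0; apply: pos_conj; exact: (lc_pos hA t0).
- move=> t t0.
  rewrite (_ : _ - _ = adjoint (adjoint (C t) \oB W) \oB (bid K - A t) \oB (adjoint (C t) \oB W)).
    by apply: pos_conj; exact: (lc_le1 hA t0).
  apply: bop_ext => v; rewrite bopBE conjugate_cocycleE adjoint_comp adjointK !bcompE.
  by rewrite bopBE !bopBr /= KC// WK.
- move=> t x t0; apply: bop_ext => v.
  rewrite bcompE [in RHS]bcompE !conjugate_cocycleE !alpha_conj// !KW !CK//.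
  by rewrite -(bcompE (A t)) (lc_comm hA)// bcompE.
- move=> s t s0 t0; apply: bop_ext => v.
  rewrite bcompE !conjugate_cocycleE alpha_conj// KW CK//.
  have -> : W \oB conjugate_cocycle A t \oB adjoint W = C t \oB A t \oB adjoint (C t).
    by apply: bop_ext => z; rewrite 2!bcompE conjugate_cocycleE !KW.
  rewrite C_add// (lc_add hA)// adjoint_comp !delta_mul// delta_adj// !bcompE.
  (* [A s] commutes with delta_s(C_t), which separates the two factors of the cocycle. *)
  by have /(congr1 (fun y : 'B(K) => y _)) /= -> := lc_comm hA (C t) s0.
- move=> v; apply: cvg_Re; apply: ip_cvgl; apply/hcvgP.
  have /hcvgP c1 := @Ca_cvg0 (W v); have /hcvgP c2 := @lc_near0 _ _ _ _ hA (W v).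
  apply: (@squeeze_cvgr _ _ _ _ (cst 0) (fun t =>
    2 * (2 * nsq (adjoint (C t) (W v) - W v) + 2 * nsq (A t (W v) - W v)) +
    2 * nsq (adjoint (C t) (W v) - W v))).
  + near=> t; have t0 : 0 <= t by near: t; exact: nbhs_right_ge.
    apply/andP; split; first exact: nsq_ge0.
    rewrite conjugate_cocycleE; set y := adjoint (C t) (W v).
    have -> : adjoint W (C t (A t y)) - v = adjoint W (C t (A t y - y)).
      by rewrite !bopBr /y KC// WK.
    rewrite nsqWa nsqC//.
    have -> : A t y - y = (A t (y - W v) + (A t (W v) - W v)) + (W v - y).
      by rewrite bopBr !addrA !subrK.
    apply: le_trans (nsqD_le _ _) _; rewrite (nsqBC (W v) y) lerD2r ler_pM2l//.
    apply: le_trans (nsqD_le _ _) _; rewrite lerD2r ler_pM2l//.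
    exact: (pos_contract _ (lc_pos hA t0) (lc_le1 hA t0)).
  + exact: cvg_cst.
  + rewrite [X in _ --> X](_ : _ = 2 * (2 * 0 + 2 * 0) + 2 * 0); last first.
      by rewrite !mulr0 !addr0 mulr0.
    by apply: cvgD; apply: cvgMr => //; apply: cvgD; apply: cvgMr.
Unshelve. all: end_near. Qed.

End CocycleConjugacy.

(** * From comparable subordinates to type I$_0$ *)

Lemma reduced_cocycle_exists (R : realType) (H1 H2 K : hilbert R)
    (tens : {bilinear H1 -> H2 -> K}) (beta : R -> 'B(H1) -> 'B(H1))
    (gamma : R -> 'B(H2) -> 'B(H2)) (delta : R -> 'B(K) -> 'B(K)) (V : R -> 'B(K)) :
  is_tensor_product tens -> E0_semigroup beta -> E0_semigroup gamma ->
  is_tensor_semigroup tens beta gamma delta -> isometric_unit delta V ->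
  exists2 rho, local_cocycle beta rho & forall t (c : R), 0 <= t -> 1 / 2 < c ->
    (forall v, c * nsq v <= complex.Re (ip H1 (rho t v) v)) -> bijective (beta t).
Proof.
move=> ht bE gE hd hV; have [g hg] := hbasis_exists H2.
have [j f1] := hbasis_unit hg.
exists (reduced ht bE gE hd hV hg f1).
  exact: reduced_local_cocycle.
by move=> t c t0 hc; exact: reduced_bijective.
Qed.

Lemma type_I0_near (R : realType) (H : hilbert R) (beta : R -> 'B(H) -> 'B(H)) :
  E0_semigroup beta -> (\forall t \near 0^'+, bijective (beta t)) -> type_I0 beta.
Proof.
move=> bE bb t t0; split; first by have [] := bE.2 t t0.
move: t0; rewrite le_eqVlt => /orP[/eqP<-|].
  by exists id => x; rewrite (cps_0 bE.1).
move: t; apply: semigroup_ind => // s t s0 t0 bs bt.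
apply: (eq_bij (f := beta s \o beta t)); first exact: bij_comp.
by move=> x /=; rewrite (cps_add bE.1) ?ltW.
Qed.

(** Testing the comparison at v (x) w for a fixed unit vector w bounds <rho_t v, v> below by c_t
    |v|^2 with c_t = e^(-kt) <sigma_t w, w>; the factor e^(k't) is at least 1. Describing [A] and
    [B] by their action on tensors makes the statement usable for either order of the factors. *)
Lemma dominating_type_I0 (R : realType) (H1 H2 K : hilbert R)
    (tens : {bilinear H1 -> H2 -> K}) (beta : R -> 'B(H1) -> 'B(H1))
    (gamma : R -> 'B(H2) -> 'B(H2)) rho sigma (A B : R -> 'B(K)) (k k' : R) :
  is_tensor_product tens -> E0_semigroup beta ->
  (forall t (c : R), 0 <= t -> 1 / 2 < c ->
    (forall v, c * nsq v <= complex.Re (ip H1 (rho t v) v)) -> bijective (beta t)) ->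
  local_cocycle gamma sigma ->
  (forall t v w, A t (tens v w) = tens (rho t v) w) ->
  (forall t v w, B t (tens v w) = tens v (sigma t w)) ->
  0 <= k' ->
  (forall t z, 0 <= t -> expR (k' * t) * complex.Re (ip K (B t z) z) <=
    expR (k * t) * complex.Re (ip K (A t z) z)) ->
  type_I0 beta.
Proof.
move=> ht bE hbij hsigma hA hB k'0 hAB; apply: type_I0_near => //.
have [w w1] := unit_vector H2.
pose c t := expR (- (k * t)) * complex.Re (ip H2 (sigma t w) w).
have cc : c t @[t --> 0^'+] --> (1 : R).
  rewrite [X in _ --> X](_ : _ = expR (- (k * 0)) * nsq w); last first.
    by rewrite mulr0 oppr0 expR0 w1 mul1r.
  apply: cvgM; last exact: (@lc_cont0 _ _ _ _ hsigma w).
  apply: cvg_at_right_filter; apply: continuous_comp; last exact: continuous_expR.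
  by apply: cvgN; exact: mulrl_continuous.
have h12 : (1 / 2 : R) < 1 by lra.
near=> t; have t0 : 0 <= t by near: t; exact: nbhs_right_ge.
have ct : 1 / 2 < c t by near: t; exact: (cvgr_gt _ cc).
apply: (hbij t (c t)) => // v.
have := hAB t (tens v w) t0; rewrite hA hB !(tens_ip ht) !ipvv w1 mulr1 cReM_real => h.
have s0 := pos_Re_ge0 w (lc_pos hsigma t0).
rewrite /c expRN -mulrA mulrC ler_pdivrMr ?expR_gt0// [leRHS]mulrC.
apply: le_trans h; rewrite (mulrC (nsq v)) ler_peMl ?mulr_ge0 ?nsq_ge0//.
by rewrite -expR0 ler_expR mulr_ge0.
Unshelve. all: end_near. Qed.

Theorem theorem6 (R : realType) (H : hilbert R)
    (alpha : R -> 'B(H) -> 'B(H)) :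
  E0_semigroup alpha -> spatial alpha -> aligned alpha -> prime_E0 alpha.
Proof.
move=> aE sp al H1 H2 K tens beta gamma delta bE gE ht hd [W [C [hW hC conjE]]].
have dE := hd.1.
have [U hU] := isometric_unit_exists aE sp.
have hV := conjugate_unit dE hW hC conjE hU; set V := (fun t => _) in hV.
have ht' := tflip_product ht; have hd' := tflip_semigroup hd.
have [rho hrho brho] := reduced_cocycle_exists ht bE gE hd hV.
have [sigma hsigma bsigma] := reduced_cocycle_exists ht' gE bE hd' hV.
have [A hA tA] := amplified_cocycle ht gE hd hrho.
have [B hB tB] := amplified_cocycle ht' bE hd' hsigma.
have hX := conjugate_local_cocycle dE hW hC conjE hA.
have hY := conjugate_local_cocycle dE hW hC conjE hB.
have [k k0 [_ mk]] := lc_trivially_maximal aE hX.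
have [l l0 [_ ml]] := lc_trivially_maximal aE hY.
(* Both cocycles are conjugated by the same unitary; testing at [adjoint W (C t z)] removes it. *)
have cmp (A' B' : R -> 'B(K)) (m n : R) :
    (forall t, 0 <= t -> pos (scale_cocycle m (conjugate_cocycle W C A') t -
      scale_cocycle n (conjugate_cocycle W C B') t)) ->
    forall t z, 0 <= t -> expR (n * t) * complex.Re (ip K (B' t z) z) <=
      expR (m * t) * complex.Re (ip K (A' t z) z).
  move=> hp t z t0; have := pos_Re_ge0 (adjoint W (C t z)) (hp t t0).
  rewrite bopBE ipBl /scale_cocycle !bopZE !ipZl cReD cReN !cReM_real.
  by rewrite !(conjugate_cocycle_ip hW hC)// subr_ge0.
(* The factor carrying the dominating cocycle is the one of type I$_0$: [gamma] if it comes from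
   sigma, [beta] if it comes from rho. *)
have [sub|sub] := al _ _ mk ml.
- right; apply: (dominating_type_I0 (k := l) (k' := k) ht' gE bsigma hrho _ _ k0).
  + by move=> t v w; exact: tB.
  + by move=> t v w; exact: tA.
  + apply: cmp => t t0; exact: (subordinate_lc aE t0 sub).
- left; apply: (dominating_type_I0 (k := k) (k' := l) ht bE brho hsigma _ _ l0).
  + by move=> t v w; exact: tA.
  + by move=> t v w; exact: tB.
  + apply: cmp => t t0; exact: (subordinate_lc aE t0 sub).
Qed.
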